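(* Assume the extensionality schemes and the identity extension schema. Let $\alpha\vdash\sigma(\alpha)$ be an inductively constructed type in which $\alpha$ occurs only positively, $\mu\alpha.\sigma(\alpha)=\Pi\alpha.(\sigma(\alpha)\multimap\alpha)\to\alpha$, $\mathit{fold}=\Lambda\alpha.\lambda f.\lambda^\circ u.\ u\,\alpha\,(!f)$, and $\mathit{in}\,z=\Lambda\alpha.\lambda f{:}\sigma(\alpha)\multimap\alpha.\ f(\sigma(\mathit{fold}\,\alpha\,(!f))\,z)$. Suppose $R:\mathrm{AdmRel}(\mu\alpha.\sigma(\alpha),\mu\alpha.\sigma(\alpha))$ is an admissible relation such that $(\sigma[R]\multimap R)(\mathit{in},\mathit{in})$. Then $\forall x:\mu\alpha.\sigma(\alpha).\ R(x,x)$.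
   Context: PILL$_Y$ is the polymorphic intuitionistic/linear lambda calculus with fixed points. Types in a context $\Xi$ of type variables are given by $\sigma ::= \alpha \mid I \mid \sigma\otimes\sigma \mid \sigma\multimap\sigma \mid\ !\sigma \mid \Pi\alpha.\sigma$. Terms are typed in judgements $\Xi\mid\Gamma;\Delta\vdash t:\tau$ with an intuitionistic variable context $\Gamma$ and a linear variable context $\Delta$; the constructs are variables, $\star:I$, linear abstraction $\lambda^\circ x{:}\sigma.t$ and application $t\,u$, $t\otimes s$, $!t$ (allowed only when the linear context is empty), type abstraction $\Lambda\alpha.t$ and type application $t\,\sigma$, the eliminations $\mathrm{let}\ x\otimes y = s\ \mathrm{in}\ t$, $\mathrm{let}\ !x = s\ \mathrm{in}\ t$, $\mathrm{let}\ \star = s\ \mathrm{in}\ t$, and a constant $Y:\Pi\alpha.(\alpha\to\alpha)\to\alpha$. Here $\sigma\to\tau$ abbreviates $!\sigma\multimap\tau$ and $\lambda x{:}\sigma.t$ abbreviates $\lambda^\circ y{:}!\sigma.\ \mathrm{let}\ !x=y\ \mathrm{in}\ t$. External equality of terms is generated by the $\beta$- and $\eta$-rules of all constructs, commuting conversions of the let-constructs with linear contexts, congruence, and $f\,(!(Y\,\sigma\,(!f))) = Y\,\sigma\,(!f)$. LAPL is an intuitionistic higher-order predicate logic over PILL$_Y$ with contexts $\Xi\mid\Gamma\mid\Theta$, where $\Theta$ declares relation variables and admissible relation variables $R:\mathrm{AdmRel}(\sigma,\tau)$; propositions include internal equality $t=_\sigma u$ (externally equal terms are internally equal), $\rho(t,u)$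 for definable relations, connectives and quantifiers over types, terms, relations and admissible relations. Admissible relations are a designated class of definable relations containing equality relations and graphs of linear terms. For relations, $(\rho\multimap\rho')(f,g)$ iff $\forall x,y.\rho(x,y)\supset\rho'(f\,x,g\,y)$. Each type $\sigma(\vec\alpha)$ has a relational interpretation $\sigma[\vec\rho]$ at admissible relations $\vec\rho$, with $\alpha_i[\vec\rho]\equiv\rho_i$, $(\sigma\multimap\sigma')[\vec\rho]\equiv\sigma[\vec\rho]\multimap\sigma'[\vec\rho]$, $(!\sigma)[\vec\rho](!x,!y)\Leftrightarrow\sigma[\vec\rho](x,y)$, and $(\Pi\beta.\sigma)[\vec\rho](t,u)\Leftrightarrow\forall\beta,\beta'.\forall R:\mathrm{AdmRel}(\beta,\beta').\ \sigma[\vec\rho,R](t\,\beta,u\,\beta')$ (and analogous clauses for $\otimes,I$). The extensionality schemes are $(\forall x.\ t\,x=u\,x)\supset t=_{\sigma\multimap\tau}u$ and $(\forall\alpha.\ t\,\alpha=u\,\alpha)\supset t=_{\Pi\alpha.\tau}u$; the identity extension schema is $\forall\vec\alpha.\ \sigma[eq_{\vec\alpha}]\equiv eq_{\sigma(\vec\alpha)}$ for every type $\sigma(\vec\alpha)$, $eq$ denoting internal equality. A type is inductively constructed if it is built from type variables and closed types using $\multimap,\otimes,I,!,\Pi$; positive/negative occurrences are as usual ($\multimap$ reverses polarity in its argument). For such $\sigma(\alpha)$ with $\alpha$ only positive, the functorial action $\sigma(f):\sigma(\tau)\multimap\sigma(\tau')$ of $f:\tau\multimap\tau'$ is the term defined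 by structural induction: $\alpha(f)=f$; closed types act by identity; $(\sigma_1\multimap\sigma_2)(f)=\lambda^\circ h.\ \sigma_2(f)\circ h\circ\sigma_1(f)$ (with $\sigma_1(f)$ going backwards); $\otimes$ componentwise; $(!\sigma_1)(f)=\lambda^\circ x.\mathrm{let}\ !y=x\ \mathrm{in}\ !(\sigma_1(f)\,y)$; $(\Pi\omega.\sigma_1)(f)=\lambda^\circ z.\Lambda\omega.\sigma_1(f)(z\,\omega)$. *)

(* Defs.v *)
From Stdlib Require List.
From mathcomp Require Import all_boot.

Set Implicit Arguments.
Unset Strict Implicit.
Unset Printing Implicit Defensive.

(** Syntax is in de Bruijn style, with separate index spaces for type, term and
    relation variables.  Renamings and substitutions are parallel and take their
    arguments in the order types, terms, relations.  When two term variables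
    [x], [y] are bound together, [x] has index 1 and [y] has index 0. *)

Definition scons (X : Type) (a : X) (s : nat -> X) : nat -> X :=
  fun i => if i is j.+1 then s j else a.

Definition upn (r : nat -> nat) : nat -> nat := scons 0 (fun i => (r i).+1).

(** ** Types of PILL_Y *)

Inductive ty : Type :=
| TVar of nat
| TI
| TTens of ty & ty
| TLolli of ty & ty
| TBang of ty
| TPi of ty.

Fixpoint ty_ren (r : nat -> nat) (A : ty) : ty :=
  match A with
  | TVar i => TVar (r i)
  | TI => TI
  | TTens A1 A2 => TTens (ty_ren r A1) (ty_ren r A2)
  | TLolli A1 A2 => TLolli (ty_ren r A1) (ty_ren r A2)
  | TBang A1 => TBang (ty_ren r A1)
  | TPi A1 => TPi (ty_ren (upn r) A1)
  end.

Definition up_ty (s : nat -> ty) : nat -> ty :=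
  scons (TVar 0) (fun i => ty_ren S (s i)).

Fixpoint ty_sub (s : nat -> ty) (A : ty) : ty :=
  match A with
  | TVar i => s i
  | TI => TI
  | TTens A1 A2 => TTens (ty_sub s A1) (ty_sub s A2)
  | TLolli A1 A2 => TLolli (ty_sub s A1) (ty_sub s A2)
  | TBang A1 => TBang (ty_sub s A1)
  | TPi A1 => TPi (ty_sub (up_ty s) A1)
  end.

Definition ty_inst (B : ty) : ty -> ty := ty_sub (scons B TVar).

(** [ty_wf n A]: the free type variables of [A] are among the first [n]. *)
Fixpoint ty_wf (n : nat) (A : ty) : bool :=
  match A with
  | TVar i => i < n
  | TI => true
  | TTens A1 A2 | TLolli A1 A2 => ty_wf n A1 && ty_wf n A2
  | TBang A1 => ty_wf n A1
  | TPi A1 => ty_wf n.+1 A1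
  end.

Definition TArr (A B : ty) : ty := TLolli (TBang A) B.

(** ** Terms of PILL_Y *)

Inductive tm : Type :=
| Var of nat
| Star
| YC
| Lam of ty & tm            (* linear abstraction *)
| App of tm & tm
| Tens of tm & tm
| Bang of tm
| TLam of tm
| TApp of tm & ty
| LetT of tm & tm           (* let x (x) y = s in t; binds two variables *)
| LetB of tm & tm           (* let !x = s in t; binds one variable *)
| LetS of tm & tm.          (* let * = s in t *)

Fixpoint tm_ren (rt re : nat -> nat) (t : tm) : tm :=
  match t with
  | Var i => Var (re i)
  | Star => Star
  | YC => YC
  | Lam A t1 => Lam (ty_ren rt A) (tm_ren rt (upn re) t1)
  | App t1 t2 => App (tm_ren rt re t1) (tm_ren rt re t2)
  | Tens t1 t2 => Tens (tm_ren rt re t1) (tm_ren rt re t2)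
  | Bang t1 => Bang (tm_ren rt re t1)
  | TLam t1 => TLam (tm_ren (upn rt) re t1)
  | TApp t1 A => TApp (tm_ren rt re t1) (ty_ren rt A)
  | LetT t1 t2 => LetT (tm_ren rt re t1) (tm_ren rt (upn (upn re)) t2)
  | LetB t1 t2 => LetB (tm_ren rt re t1) (tm_ren rt (upn re) t2)
  | LetS t1 t2 => LetS (tm_ren rt re t1) (tm_ren rt re t2)
  end.

(** [tm_shift a b t] weakens [t] by [a] type variables and [b] term variables. *)
Definition tm_shift (a b : nat) : tm -> tm := tm_ren (addn a) (addn b).

Definition up_tm (e : nat -> tm) : nat -> tm :=
  scons (Var 0) (fun i => tm_shift 0 1 (e i)).

Fixpoint tm_sub (s : nat -> ty) (e : nat -> tm) (t : tm) : tm :=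
  match t with
  | Var i => e i
  | Star => Star
  | YC => YC
  | Lam A t1 => Lam (ty_sub s A) (tm_sub s (up_tm e) t1)
  | App t1 t2 => App (tm_sub s e t1) (tm_sub s e t2)
  | Tens t1 t2 => Tens (tm_sub s e t1) (tm_sub s e t2)
  | Bang t1 => Bang (tm_sub s e t1)
  | TLam t1 => TLam (tm_sub (up_ty s) (fun i => tm_shift 1 0 (e i)) t1)
  | TApp t1 A => TApp (tm_sub s e t1) (ty_sub s A)
  | LetT t1 t2 => LetT (tm_sub s e t1) (tm_sub s (up_tm (up_tm e)) t2)
  | LetB t1 t2 => LetB (tm_sub s e t1) (tm_sub s (up_tm e) t2)
  | LetS t1 t2 => LetS (tm_sub s e t1) (tm_sub s e t2)
  end.

Definition tm_inst (u : tm) : tm -> tm := tm_sub TVar (scons u Var).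
Definition tm_inst2 (u v : tm) : tm -> tm := tm_sub TVar (scons v (scons u Var)).
Definition tm_tinst (A : ty) : tm -> tm := tm_sub (scons A TVar) Var.

(** The abbreviation lambda x:A. t = lambda° y:!A. let !x = y in t. *)
Definition LamI (A : ty) (t : tm) : tm :=
  Lam (TBang A) (LetB (Var 0) (tm_ren id (upn S) t)).

(** ** Typing

    The pair Gamma;Delta is a single list in which each variable is declared
    intuitionistic or linear.  [Off] marks a position whose linear variable
    belongs to another subterm, so that splitting Delta preserves indices. *)

Inductive hyp : Type := Int of ty | Lin of ty | Off.

Definition hyp_ren (r : nat -> nat) (h : hyp) : hyp :=
  match h with Int A => Int (ty_ren r A) | Lin A => Lin (ty_ren r A) | Off => Off end.

Definition not_linear (h : hyp) : bool := if h is Lin _ then false else true.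

Definition no_linear (G : seq hyp) : bool := all not_linear G.

Inductive hyp_split : seq hyp -> seq hyp -> seq hyp -> Prop :=
| hyp_split_nil : hyp_split [::] [::] [::]
| hyp_split_int A G G1 G2 :
    hyp_split G G1 G2 -> hyp_split (Int A :: G) (Int A :: G1) (Int A :: G2)
| hyp_split_off G G1 G2 : hyp_split G G1 G2 -> hyp_split (Off :: G) (Off :: G1) (Off :: G2)
| hyp_split_l A G G1 G2 :
    hyp_split G G1 G2 -> hyp_split (Lin A :: G) (Lin A :: G1) (Off :: G2)
| hyp_split_r A G G1 G2 :
    hyp_split G G1 G2 -> hyp_split (Lin A :: G) (Off :: G1) (Lin A :: G2).

Definition Y_type : ty := TPi (TArr (TArr (TVar 0) (TVar 0)) (TVar 0)).

Inductive has_type : nat -> seq hyp -> tm -> ty -> Prop :=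
| ht_int n G i A :
    onth G i = Some (Int A) -> no_linear G -> has_type n G (Var i) A
| ht_lin n G i A :
    onth G i = Some (Lin A) -> no_linear (set_nth Off G i Off) ->
    has_type n G (Var i) A
| ht_star n G : no_linear G -> has_type n G Star TI
| ht_Y n G : no_linear G -> has_type n G YC Y_type
| ht_lam n G A B t :
    ty_wf n A -> has_type n (Lin A :: G) t B -> has_type n G (Lam A t) (TLolli A B)
| ht_app n G G1 G2 A B t u :
    hyp_split G G1 G2 -> has_type n G1 t (TLolli A B) -> has_type n G2 u A ->
    has_type n G (App t u) B
| ht_tens n G G1 G2 A B t u :
    hyp_split G G1 G2 -> has_type n G1 t A -> has_type n G2 u B ->
    has_type n G (Tens t u) (TTens A B)
| ht_bang n G A t :
    no_linear G -> has_type n G t A -> has_type n G (Bang t) (TBang A)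
| ht_tlam n G A t :
    has_type n.+1 (map (hyp_ren S) G) t A -> has_type n G (TLam t) (TPi A)
| ht_tapp n G A B t :
    ty_wf n B -> has_type n G t (TPi A) -> has_type n G (TApp t B) (ty_inst B A)
| ht_lett n G G1 G2 A B C s t :
    hyp_split G G1 G2 -> has_type n G1 s (TTens A B) ->
    has_type n (Lin B :: Lin A :: G2) t C -> has_type n G (LetT s t) C
| ht_letb n G G1 G2 A C s t :
    hyp_split G G1 G2 -> has_type n G1 s (TBang A) ->
    has_type n (Int A :: G2) t C -> has_type n G (LetB s t) C
| ht_lets n G G1 G2 C s t :
    hyp_split G G1 G2 -> has_type n G1 s TI -> has_type n G2 t C ->
    has_type n G (LetS s t) C.

(** ** External equality

    In the commuting conversions the linear context C[-] is a term [c] whose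
    linear variable 0 is the hole.  Conversions whose context binds variables of
    the term in the hole follow from these with the beta- and eta-rules. *)

Inductive teq : nat -> seq hyp -> tm -> tm -> ty -> Prop :=
| teq_refl n G t A : has_type n G t A -> teq n G t t A
| teq_sym n G t u A : teq n G t u A -> teq n G u t A
| teq_trans n G t u v A : teq n G t u A -> teq n G u v A -> teq n G t v A
(* congruence *)
| teq_lam n G A B t t' :
    ty_wf n A -> teq n (Lin A :: G) t t' B ->
    teq n G (Lam A t) (Lam A t') (TLolli A B)
| teq_app n G G1 G2 A B t t' u u' :
    hyp_split G G1 G2 -> teq n G1 t t' (TLolli A B) -> teq n G2 u u' A ->
    teq n G (App t u) (App t' u') B
| teq_tens n G G1 G2 A B t t' u u' :
    hyp_split G G1 G2 -> teq n G1 t t' A -> teq n G2 u u' B ->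
    teq n G (Tens t u) (Tens t' u') (TTens A B)
| teq_bang n G A t t' :
    no_linear G -> teq n G t t' A -> teq n G (Bang t) (Bang t') (TBang A)
| teq_tlam n G A t t' :
    teq n.+1 (map (hyp_ren S) G) t t' A -> teq n G (TLam t) (TLam t') (TPi A)
| teq_tapp n G A B t t' :
    ty_wf n B -> teq n G t t' (TPi A) -> teq n G (TApp t B) (TApp t' B) (ty_inst B A)
| teq_lett n G G1 G2 A B C s s' t t' :
    hyp_split G G1 G2 -> teq n G1 s s' (TTens A B) ->
    teq n (Lin B :: Lin A :: G2) t t' C -> teq n G (LetT s t) (LetT s' t') C
| teq_letb n G G1 G2 A C s s' t t' :
    hyp_split G G1 G2 -> teq n G1 s s' (TBang A) ->
    teq n (Int A :: G2) t t' C -> teq n G (LetB s t) (LetB s' t') C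
| teq_lets n G G1 G2 C s s' t t' :
    hyp_split G G1 G2 -> teq n G1 s s' TI -> teq n G2 t t' C ->
    teq n G (LetS s t) (LetS s' t') C
(* beta *)
| teq_beta_lam n G A B t u :
    has_type n G (App (Lam A t) u) B -> teq n G (App (Lam A t) u) (tm_inst u t) B
| teq_beta_tlam n G A B t :
    has_type n G (TApp (TLam t) A) B -> teq n G (TApp (TLam t) A) (tm_tinst A t) B
| teq_beta_tens n G C s u t :
    has_type n G (LetT (Tens s u) t) C ->
    teq n G (LetT (Tens s u) t) (tm_inst2 s u t) C
| teq_beta_bang n G C s t :
    has_type n G (LetB (Bang s) t) C -> teq n G (LetB (Bang s) t) (tm_inst s t) C
| teq_beta_star n G C t :
    has_type n G (LetS Star t) C -> teq n G (LetS Star t) t C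
(* eta *)
| teq_eta_lam n G A B t :
    ty_wf n A -> has_type n G t (TLolli A B) ->
    teq n G (Lam A (App (tm_shift 0 1 t) (Var 0))) t (TLolli A B)
| teq_eta_tlam n G A t :
    has_type n G t (TPi A) ->
    teq n G (TLam (TApp (tm_shift 1 0 t) (TVar 0))) t (TPi A)
| teq_eta_tens n G A B t :
    has_type n G t (TTens A B) ->
    teq n G (LetT t (Tens (Var 1) (Var 0))) t (TTens A B)
| teq_eta_bang n G A t :
    has_type n G t (TBang A) -> teq n G (LetB t (Bang (Var 0))) t (TBang A)
| teq_eta_star n G t :
    has_type n G t TI -> teq n G (LetS t Star) t TI
(* commuting conversions *)
| teq_comm_tens n G Gc Gl A B c s t :
    hyp_split G Gc Gl -> has_type n (Lin A :: Gc) c B -> has_type n Gl (LetT s t) A ->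
    teq n G (LetT s (tm_sub TVar (scons t (fun i => Var i.+2)) c))
            (tm_inst (LetT s t) c) B
| teq_comm_bang n G Gc Gl A B c s t :
    hyp_split G Gc Gl -> has_type n (Lin A :: Gc) c B -> has_type n Gl (LetB s t) A ->
    teq n G (LetB s (tm_sub TVar (scons t (fun i => Var i.+1)) c))
            (tm_inst (LetB s t) c) B
| teq_comm_star n G Gc Gl A B c s t :
    hyp_split G Gc Gl -> has_type n (Lin A :: Gc) c B -> has_type n Gl (LetS s t) A ->
    teq n G (LetS s (tm_inst t c)) (tm_inst (LetS s t) c) B
(* fixed points *)
| teq_Y n G A f :
    ty_wf n A -> no_linear G -> has_type n G f (TArr A A) ->
    teq n G (App f (Bang (App (TApp YC A) (Bang f)))) (App (TApp YC A) (Bang f)) A.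

(** ** Propositions and definable relations of LAPL *)

Inductive quant : Type := All | Ex.

(** In [PQRel q a A B P] the bound variable ranges over AdmRel(A,B) if [a] and
    over Rel(A,B) otherwise.  In [RInt A rs], the relation A[rs], the type
    variable [i] of [A] is bound to the [i]-th element of [rs]; [A] is therefore
    unaffected by substitution. *)
Inductive form : Type :=
| PEq of ty & tm & tm
| PRel of drel & tm & tm
| PTop
| PBot
| PAnd of form & form
| POr of form & form
| PImp of form & form
| PQTy of quant & form
| PQTm of quant & ty & form
| PQRel of quant & bool & ty & ty & form
with drel : Type :=
| RVar of nat
| RComp of ty & ty & form   (* (x:A, y:B). P *)
| RInt of ty & seq drel.

Fixpoint form_ren (rt re rr : nat -> nat) (P : form) {struct P} : form :=
  match P with
  | PEq A t u => PEq (ty_ren rt A) (tm_ren rt re t) (tm_ren rt re u)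
  | PRel r t u => PRel (rel_ren rt re rr r) (tm_ren rt re t) (tm_ren rt re u)
  | PTop => PTop
  | PBot => PBot
  | PAnd P1 P2 => PAnd (form_ren rt re rr P1) (form_ren rt re rr P2)
  | POr P1 P2 => POr (form_ren rt re rr P1) (form_ren rt re rr P2)
  | PImp P1 P2 => PImp (form_ren rt re rr P1) (form_ren rt re rr P2)
  | PQTy q P1 => PQTy q (form_ren (upn rt) re rr P1)
  | PQTm q A P1 => PQTm q (ty_ren rt A) (form_ren rt (upn re) rr P1)
  | PQRel q a A B P1 =>
      PQRel q a (ty_ren rt A) (ty_ren rt B) (form_ren rt re (upn rr) P1)
  end
with rel_ren (rt re rr : nat -> nat) (r : drel) {struct r} : drel :=
  match r with
  | RVar i => RVar (rr i)
  | RComp A B P =>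
      RComp (ty_ren rt A) (ty_ren rt B) (form_ren rt (upn (upn re)) rr P)
  | RInt A rs => RInt A (map (rel_ren rt re rr) rs)
  end.

(** Weakening by [a] type, [b] term and [c] relation variables. *)
Definition form_shift (a b c : nat) : form -> form :=
  form_ren (addn a) (addn b) (addn c).
Definition rel_shift (a b c : nat) : drel -> drel :=
  rel_ren (addn a) (addn b) (addn c).

Definition up_rel (r : nat -> drel) : nat -> drel :=
  scons (RVar 0) (fun i => rel_shift 0 0 1 (r i)).

Fixpoint form_sub (s : nat -> ty) (e : nat -> tm) (r : nat -> drel) (P : form)
    {struct P} : form :=
  match P with
  | PEq A t u => PEq (ty_sub s A) (tm_sub s e t) (tm_sub s e u)
  | PRel R t u => PRel (rel_sub s e r R) (tm_sub s e t) (tm_sub s e u)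
  | PTop => PTop
  | PBot => PBot
  | PAnd P1 P2 => PAnd (form_sub s e r P1) (form_sub s e r P2)
  | POr P1 P2 => POr (form_sub s e r P1) (form_sub s e r P2)
  | PImp P1 P2 => PImp (form_sub s e r P1) (form_sub s e r P2)
  | PQTy q P1 =>
      PQTy q (form_sub (up_ty s) (fun i => tm_shift 1 0 (e i))
                       (fun i => rel_shift 1 0 0 (r i)) P1)
  | PQTm q A P1 =>
      PQTm q (ty_sub s A) (form_sub s (up_tm e) (fun i => rel_shift 0 1 0 (r i)) P1)
  | PQRel q a A B P1 =>
      PQRel q a (ty_sub s A) (ty_sub s B) (form_sub s e (up_rel r) P1)
  end
with rel_sub (s : nat -> ty) (e : nat -> tm) (r : nat -> drel) (R : drel)
    {struct R} : drel :=
  match R with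
  | RVar i => r i
  | RComp A B P =>
      RComp (ty_sub s A) (ty_sub s B)
        (form_sub s (up_tm (up_tm e)) (fun i => rel_shift 0 2 0 (r i)) P)
  | RInt A rs => RInt A (map (rel_sub s e r) rs)
  end.

Definition form_inst_ty (A : ty) : form -> form := form_sub (scons A TVar) Var RVar.
Definition form_inst_tm (t : tm) : form -> form := form_sub TVar (scons t Var) RVar.
Definition form_inst_tm2 (t u : tm) : form -> form :=
  form_sub TVar (scons u (scons t Var)) RVar.
Definition form_inst_rel (r : drel) : form -> form := form_sub TVar Var (scons r RVar).

Notation PIff P Q := (PAnd (PImp P Q) (PImp Q P)).
Notation PAllTy := (PQTy All).
Notation PAllTm := (PQTm All).
Notation PAllAdm := (PQRel All true).

(** ** Constructions on relations

    In each of these, [r] relates [A] and [B], and [r'] relates [A'] and [B']. *)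

Definition req (A : ty) : drel := RComp A A (PEq A (Var 1) (Var 0)).

Definition rel_graph (A B : ty) (f : tm) : drel :=
  RComp A B (PEq B (App (tm_shift 0 2 f) (Var 1)) (Var 0)).

Definition rel_equiv (A B : ty) (r r' : drel) : form :=
  PAllTm A (PAllTm B
    (PIff (PRel (rel_shift 0 2 0 r) (Var 1) (Var 0))
          (PRel (rel_shift 0 2 0 r') (Var 1) (Var 0)))).

Definition rlolli (A B A' B' : ty) (r r' : drel) : drel :=
  RComp (TLolli A A') (TLolli B B')
    (PAllTm A (PAllTm B
       (PImp (PRel (rel_shift 0 4 0 r) (Var 1) (Var 0))
             (PRel (rel_shift 0 4 0 r') (App (Var 3) (Var 1)) (App (Var 2) (Var 0)))))).

(** (t, u). forall b, b'. forall R : AdmRel(b,b'). r (t b, u b'), where [r] lives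
    under the binders of t, u, b, b' and R. *)
Definition rpi (A B : ty) (r : drel) : drel :=
  RComp (TPi A) (TPi B)
    (PAllTy (PAllTy (PAllAdm (TVar 1) (TVar 0)
       (PRel r (TApp (Var 1) (TVar 1)) (TApp (Var 0) (TVar 0)))))).

(** The relations on tensors, on I and on !-types are the impredicative ones:
    (x,y). forall a, b. forall R : AdmRel(a,b). forall t : A -o A' -o a,
      u : B -o B' -o b. (r -o r' -o R)(t,u) implies
      R(let x' (x) x'' = x in t x' x'', let y' (x) y'' = y in u y' y''),
    and similarly for I and !. *)
Definition rtens (A B A' B' : ty) (r r' : drel) : drel :=
  let a := TVar 1 in let b := TVar 0 in
  let up2 := ty_ren (addn 2) in
  RComp (TTens A A') (TTens B B')
    (PAllTy (PAllTy (PAllAdm a b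
       (PAllTm (TLolli (up2 A) (TLolli (up2 A') a))
       (PAllTm (TLolli (up2 B) (TLolli (up2 B') b))
       (PImp
          (PRel (rlolli (up2 A) (up2 B) (TLolli (up2 A') a) (TLolli (up2 B') b)
                   (rel_shift 2 4 1 r)
                   (rlolli (up2 A') (up2 B') a b (rel_shift 2 4 1 r') (RVar 0)))
                (Var 1) (Var 0))
          (PRel (RVar 0)
                (LetT (Var 3) (App (App (Var 3) (Var 1)) (Var 0)))
                (LetT (Var 2) (App (App (Var 2) (Var 1)) (Var 0)))))))))).

Definition rI : drel :=
  let a := TVar 1 in let b := TVar 0 in
  RComp TI TI
    (PAllTy (PAllTy (PAllAdm a b (PAllTm a (PAllTm b
       (PImp (PRel (RVar 0) (Var 1) (Var 0))
             (PRel (RVar 0) (LetS (Var 3) (Var 1)) (LetS (Var 2) (Var 0))))))))).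

Definition rbang (A B : ty) (r : drel) : drel :=
  let a := TVar 1 in let b := TVar 0 in
  let up2 := ty_ren (addn 2) in
  RComp (TBang A) (TBang B)
    (PAllTy (PAllTy (PAllAdm a b
       (PAllTm (TArr (up2 A) a) (PAllTm (TArr (up2 B) b)
       (PImp
          (PAllTm (up2 A) (PAllTm (up2 B)
             (PImp (PRel (rel_shift 2 6 1 r) (Var 1) (Var 0))
                   (PRel (RVar 0) (App (Var 3) (Bang (Var 1)))
                                  (App (Var 2) (Bang (Var 0)))))))
          (PRel (RVar 0) (App (Var 1) (Var 3)) (App (Var 0) (Var 2))))))))).

(** ** Well-formedness *)

Record rdecl : Type := RDecl { rd_adm : bool; rd_dom : ty; rd_cod : ty }.

Definition rd_ren (r : nat -> nat) (d : rdecl) : rdecl :=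
  RDecl (rd_adm d) (ty_ren r (rd_dom d)) (ty_ren r (rd_cod d)).

(** Contexts Xi | Gamma | Theta; the term variables are intuitionistic. *)
Record ctx : Type := Ctx { c_ty : nat; c_tm : seq ty; c_rel : seq rdecl }.

Definition ext_ty (C : ctx) : ctx :=
  Ctx (c_ty C).+1 (map (ty_ren S) (c_tm C)) (map (rd_ren S) (c_rel C)).
Definition ext_tm (A : ty) (C : ctx) : ctx := Ctx (c_ty C) (A :: c_tm C) (c_rel C).
Definition ext_rel (a : bool) (A B : ty) (C : ctx) : ctx :=
  Ctx (c_ty C) (c_tm C) (RDecl a A B :: c_rel C).

Definition ctx_wf (C : ctx) : bool :=
  all (ty_wf (c_ty C)) (c_tm C) &&
  all (fun d => ty_wf (c_ty C) (rd_dom d) && ty_wf (c_ty C) (rd_cod d)) (c_rel C).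

Definition tm_in (C : ctx) (t : tm) (A : ty) : Prop :=
  has_type (c_ty C) (map Int (c_tm C)) t A.

Definition tm_eq_in (C : ctx) (t u : tm) (A : ty) : Prop :=
  teq (c_ty C) (map Int (c_tm C)) t u A.

(** A theory over PILL_Y fixes the designated class of admissible relations,
    [adm L C r A B] being the judgement C |- r : AdmRel(A,B), and the axioms
    assumed in addition to the rules of LAPL. *)
Record theory : Type := Theory {
  adm : ctx -> drel -> ty -> ty -> Prop;
  axm : ctx -> form -> Prop }.

(** [rel_env L C n rs s s']: [rs] is a list of [n] admissible relations, the
    [i]-th one between [s i] and [s' i]. *)
Definition rel_env (L : theory) (C : ctx) (n : nat) (rs : seq drel)
    (s s' : nat -> ty) : Prop :=
  size rs = n /\
  forall i, i < n ->
    [/\ ty_wf (c_ty C) (s i), ty_wf (c_ty C) (s' i) &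
        adm L C (nth (RVar 0) rs i) (s i) (s' i)].

Inductive form_wf (L : theory) : ctx -> form -> Prop :=
| wf_eq C A t u : tm_in C t A -> tm_in C u A -> form_wf L C (PEq A t u)
| wf_rel C r A B t u :
    rel_wf L C r A B -> tm_in C t A -> tm_in C u B -> form_wf L C (PRel r t u)
| wf_top C : form_wf L C PTop
| wf_bot C : form_wf L C PBot
| wf_and C P Q : form_wf L C P -> form_wf L C Q -> form_wf L C (PAnd P Q)
| wf_or C P Q : form_wf L C P -> form_wf L C Q -> form_wf L C (POr P Q)
| wf_imp C P Q : form_wf L C P -> form_wf L C Q -> form_wf L C (PImp P Q)
| wf_qty C q P : form_wf L (ext_ty C) P -> form_wf L C (PQTy q P)
| wf_qtm C q A P :
    ty_wf (c_ty C) A -> form_wf L (ext_tm A C) P -> form_wf L C (PQTm q A P)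
| wf_qrel C q a A B P :
    ty_wf (c_ty C) A -> ty_wf (c_ty C) B -> form_wf L (ext_rel a A B C) P ->
    form_wf L C (PQRel q a A B P)
with rel_wf (L : theory) : ctx -> drel -> ty -> ty -> Prop :=
| wf_rvar C i a A B :
    onth (c_rel C) i = Some (RDecl a A B) -> rel_wf L C (RVar i) A B
| wf_rcomp C A B P :
    ty_wf (c_ty C) A -> ty_wf (c_ty C) B -> form_wf L (ext_tm B (ext_tm A C)) P ->
    rel_wf L C (RComp A B P) A B
| wf_rint C A n rs s s' :
    ty_wf n A -> rel_env L C n rs s s' ->
    rel_wf L C (RInt A rs) (ty_sub s A) (ty_sub s' A).

Definition rel_ok (L : theory) (a : bool) (C : ctx) (r : drel) (A B : ty) : Prop :=
  if a then adm L C r A B else rel_wf L C r A B.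

(** [sub_ok L C C' s e r]: a substitution for the variables of [C] over [C']. *)
Definition sub_ok (L : theory) (C C' : ctx)
    (s : nat -> ty) (e : nat -> tm) (r : nat -> drel) : Prop :=
  [/\ forall i, i < c_ty C -> ty_wf (c_ty C') (s i),
      forall i A, onth (c_tm C) i = Some A -> tm_in C' (e i) (ty_sub s A) &
      forall i a A B, onth (c_rel C) i = Some (RDecl a A B) ->
        rel_ok L a C' (r i) (ty_sub s A) (ty_sub s B)].

(** What is required of the designated class: it consists of definable relations,
    is stable under substitution, and contains the admissible relation variables,
    equality relations, graphs of linear terms, and the relations A[rs]. *)
Record adm_class (L : theory) : Prop := AdmClass {
  adm_definable : forall C r A B, ctx_wf C -> adm L C r A B -> rel_wf L C r A B;
  adm_sub : forall C C' s e r R A B,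
    ctx_wf C -> ctx_wf C' -> sub_ok L C C' s e r -> adm L C R A B ->
    adm L C' (rel_sub s e r R) (ty_sub s A) (ty_sub s B);
  adm_var : forall C i A B, ctx_wf C ->
    onth (c_rel C) i = Some (RDecl true A B) -> adm L C (RVar i) A B;
  adm_eq : forall C A, ctx_wf C -> ty_wf (c_ty C) A -> adm L C (req A) A A;
  adm_graph : forall C f A B, ctx_wf C ->
    ty_wf (c_ty C) A -> ty_wf (c_ty C) B ->
    tm_in C f (TLolli A B) -> adm L C (rel_graph A B f) A B;
  adm_int : forall C A n rs s s', ctx_wf C ->
    ty_wf n A -> rel_env L C n rs s s' ->
    adm L C (RInt A rs) (ty_sub s A) (ty_sub s' A) }.

(** ** Deduction *)

Notation pshift a b c := (map (form_shift a b c)).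

(** [prov L C H P]: the sequent C | H |- P, for [H] a list of hypotheses. *)
Inductive prov (L : theory) : ctx -> seq form -> form -> Prop :=
| pr_axm C H P : form_wf L C P -> axm L C P -> prov L C H P
| pr_hyp C H P : List.In P H -> prov L C H P
| pr_weak C H H' P : List.incl H H' -> prov L C H P -> prov L C H' P
(* connectives *)
| pr_top C H : prov L C H PTop
| pr_botE C H P : form_wf L C P -> prov L C H PBot -> prov L C H P
| pr_andI C H P Q : prov L C H P -> prov L C H Q -> prov L C H (PAnd P Q)
| pr_andE1 C H P Q : prov L C H (PAnd P Q) -> prov L C H P
| pr_andE2 C H P Q : prov L C H (PAnd P Q) -> prov L C H Q
| pr_orI1 C H P Q : form_wf L C Q -> prov L C H P -> prov L C H (POr P Q)
| pr_orI2 C H P Q : form_wf L C P -> prov L C H Q -> prov L C H (POr P Q)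
| pr_orE C H P Q T :
    prov L C H (POr P Q) -> prov L C (P :: H) T -> prov L C (Q :: H) T ->
    prov L C H T
| pr_impI C H P Q : form_wf L C P -> prov L C (P :: H) Q -> prov L C H (PImp P Q)
| pr_impE C H P Q : prov L C H (PImp P Q) -> prov L C H P -> prov L C H Q
(* quantifiers over types *)
| pr_allTyI C H P : prov L (ext_ty C) (pshift 1 0 0 H) P -> prov L C H (PQTy All P)
| pr_allTyE C H P A :
    ty_wf (c_ty C) A -> prov L C H (PQTy All P) -> prov L C H (form_inst_ty A P)
| pr_exTyI C H P A :
    form_wf L C (PQTy Ex P) -> ty_wf (c_ty C) A ->
    prov L C H (form_inst_ty A P) -> prov L C H (PQTy Ex P)
| pr_exTyE C H P Q :
    prov L C H (PQTy Ex P) ->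
    prov L (ext_ty C) (P :: pshift 1 0 0 H) (form_shift 1 0 0 Q) -> prov L C H Q
(* quantifiers over terms *)
| pr_allTmI C H A P :
    ty_wf (c_ty C) A ->
    prov L (ext_tm A C) (pshift 0 1 0 H) P -> prov L C H (PQTm All A P)
| pr_allTmE C H A P t :
    tm_in C t A -> prov L C H (PQTm All A P) -> prov L C H (form_inst_tm t P)
| pr_exTmI C H A P t :
    form_wf L C (PQTm Ex A P) -> tm_in C t A ->
    prov L C H (form_inst_tm t P) -> prov L C H (PQTm Ex A P)
| pr_exTmE C H A P Q :
    prov L C H (PQTm Ex A P) ->
    prov L (ext_tm A C) (P :: pshift 0 1 0 H) (form_shift 0 1 0 Q) -> prov L C H Q
(* quantifiers over relations and admissible relations *)
| pr_allRelI C H a A B P :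
    ty_wf (c_ty C) A -> ty_wf (c_ty C) B ->
    prov L (ext_rel a A B C) (pshift 0 0 1 H) P -> prov L C H (PQRel All a A B P)
| pr_allRelE C H a A B P r :
    rel_ok L a C r A B ->
    prov L C H (PQRel All a A B P) -> prov L C H (form_inst_rel r P)
| pr_exRelI C H a A B P r :
    form_wf L C (PQRel Ex a A B P) -> rel_ok L a C r A B ->
    prov L C H (form_inst_rel r P) -> prov L C H (PQRel Ex a A B P)
| pr_exRelE C H a A B P Q :
    prov L C H (PQRel Ex a A B P) ->
    prov L (ext_rel a A B C) (P :: pshift 0 0 1 H) (form_shift 0 0 1 Q) ->
    prov L C H Q
(* internal equality *)
| pr_eqI C H A t u : tm_eq_in C t u A -> tm_in C t A -> tm_in C u A ->
    prov L C H (PEq A t u)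
| pr_eqE C H A t u P :
    form_wf L (ext_tm A C) P ->
    prov L C H (PEq A t u) -> prov L C H (form_inst_tm t P) ->
    prov L C H (form_inst_tm u P)
(* comprehension *)
| pr_comp C H A B P t u :
    form_wf L C (PRel (RComp A B P) t u) ->
    prov L C H (PIff (PRel (RComp A B P) t u) (form_inst_tm2 t u P))
(* relational interpretation of types *)
| pr_int_var C H n rs s s' i :
    rel_env L C n rs s s' -> i < n ->
    prov L C H (rel_equiv (s i) (s' i) (RInt (TVar i) rs) (nth (RVar 0) rs i))
| pr_int_lolli C H n rs s s' A A' :
    rel_env L C n rs s s' -> ty_wf n A -> ty_wf n A' ->
    prov L C H (rel_equiv (ty_sub s (TLolli A A')) (ty_sub s' (TLolli A A'))
      (RInt (TLolli A A') rs)
      (rlolli (ty_sub s A) (ty_sub s' A) (ty_sub s A') (ty_sub s' A')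
              (RInt A rs) (RInt A' rs)))
| pr_int_pi C H n rs s s' A :
    rel_env L C n rs s s' -> ty_wf n.+1 A ->
    prov L C H (rel_equiv (ty_sub s (TPi A)) (ty_sub s' (TPi A))
      (RInt (TPi A) rs)
      (rpi (ty_sub (up_ty s) A) (ty_sub (up_ty s') A)
           (RInt A (RVar 0 :: map (rel_shift 2 2 1) rs))))
| pr_int_tens C H n rs s s' A A' :
    rel_env L C n rs s s' -> ty_wf n A -> ty_wf n A' ->
    prov L C H (rel_equiv (ty_sub s (TTens A A')) (ty_sub s' (TTens A A'))
      (RInt (TTens A A') rs)
      (rtens (ty_sub s A) (ty_sub s' A) (ty_sub s A') (ty_sub s' A')
             (RInt A rs) (RInt A' rs)))
| pr_int_I C H n rs s s' :
    rel_env L C n rs s s' -> prov L C H (rel_equiv TI TI (RInt TI rs) rI)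
| pr_int_bang C H n rs s s' A :
    rel_env L C n rs s s' -> ty_wf n A ->
    prov L C H (rel_equiv (ty_sub s (TBang A)) (ty_sub s' (TBang A))
      (RInt (TBang A) rs) (rbang (ty_sub s A) (ty_sub s' A) (RInt A rs)))
| pr_int_bang_val C H n rs s s' A t u :
    rel_env L C n rs s s' -> ty_wf n A ->
    tm_in C t (ty_sub s A) -> tm_in C u (ty_sub s' A) ->
    prov L C H (PIff (PRel (RInt (TBang A) rs) (Bang t) (Bang u))
                     (PRel (RInt A rs) t u)).

(** ** Extensionality and identity extension *)

Definition ext_lolli (A B : ty) (t u : tm) : form :=
  PImp (PAllTm A (PEq B (App (tm_shift 0 1 t) (Var 0)) (App (tm_shift 0 1 u) (Var 0))))
       (PEq (TLolli A B) t u).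

Definition ext_pi (A : ty) (t u : tm) : form :=
  PImp (PAllTy (PEq A (TApp (tm_shift 1 0 t) (TVar 0))
                      (TApp (tm_shift 1 0 u) (TVar 0))))
       (PEq (TPi A) t u).

Definition extensionality (L : theory) : Prop :=
  (forall C A B t u, ctx_wf C -> ty_wf (c_ty C) A -> ty_wf (c_ty C) B ->
     tm_in C t (TLolli A B) -> tm_in C u (TLolli A B) ->
     prov L C [::] (ext_lolli A B t u)) /\
  (forall C A t u, ctx_wf C -> ty_wf (c_ty C).+1 A ->
     tm_in C t (TPi A) -> tm_in C u (TPi A) ->
     prov L C [::] (ext_pi A t u)).

(** The closed proposition forall a_0, ..., a_(n-1). A[eq_a0, ...] == eq_A. *)
Definition id_ext (n : nat) (A : ty) : form :=
  iter n PAllTy (rel_equiv A A (RInt A (mkseq (fun i => req (TVar i)) n)) (req A)).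

Definition identity_extension (L : theory) : Prop :=
  forall C n A, ctx_wf C -> ty_wf n A -> prov L C [::] (id_ext n A).

(** ** Inductively constructed types and their functorial action *)

Inductive ind_constructed : ty -> Prop :=
| ic_var i : ind_constructed (TVar i)
| ic_closed A : ty_wf 0 A -> ind_constructed A
| ic_lolli A B : ind_constructed A -> ind_constructed B -> ind_constructed (TLolli A B)
| ic_tens A B : ind_constructed A -> ind_constructed B -> ind_constructed (TTens A B)
| ic_I : ind_constructed TI
| ic_bang A : ind_constructed A -> ind_constructed (TBang A)
| ic_pi A : ind_constructed A -> ind_constructed (TPi A).

(** [occurs_only p k A]: the type variable [k] occurs only positively ([p] true),
    respectively only negatively ([p] false), in [A]. *)
Fixpoint occurs_only (p : bool) (k : nat) (A : ty) : bool :=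
  match A with
  | TVar i => (i == k) ==> p
  | TI => true
  | TTens A1 A2 => occurs_only p k A1 && occurs_only p k A2
  | TLolli A1 A2 => occurs_only (~~ p) k A1 && occurs_only p k A2
  | TBang A1 => occurs_only p k A1
  | TPi A1 => occurs_only p k.+1 A1
  end.

(** [fun_act k s s' f A] is the action of [A] on [f], in the variable [k], as a
    term of type [ty_sub s A -o ty_sub s' A].  For [k] only positive in [A], the
    substitutions [s], [s'] send [k] to the domain and codomain of [f]; for [k]
    only negative, to its codomain and domain.  They agree elsewhere. *)
Fixpoint fun_act (k : nat) (s s' : nat -> ty) (f : tm) (A : ty) : tm :=
  if ty_wf 0 A then Lam A (Var 0) else
  match A with
  | TVar i => if i == k then f else Lam (s i) (Var 0)
  | TI => Lam TI (Var 0)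
  | TLolli A1 A2 =>
      Lam (ty_sub s A) (Lam (ty_sub s' A1)
        (App (fun_act k s s' (tm_shift 0 2 f) A2)
             (App (Var 1) (App (fun_act k s' s (tm_shift 0 2 f) A1) (Var 0)))))
  | TTens A1 A2 =>
      Lam (ty_sub s A) (LetT (Var 0)
        (Tens (App (fun_act k s s' (tm_shift 0 3 f) A1) (Var 1))
              (App (fun_act k s s' (tm_shift 0 3 f) A2) (Var 0))))
  | TBang A1 =>
      Lam (ty_sub s A) (LetB (Var 0)
        (Bang (App (fun_act k s s' (tm_shift 0 2 f) A1) (Var 0))))
  | TPi A1 =>
      Lam (ty_sub s A) (TLam
        (App (fun_act k.+1 (up_ty s) (up_ty s') (tm_shift 1 1 f) A1)
             (TApp (Var 0) (TVar 0))))
  end.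

(** sigma(f) : sigma(A) -o sigma(B), for f : A -o B and alpha |- sigma(alpha). *)
Definition functor_act (sigma A B : ty) (f : tm) : tm :=
  fun_act 0 (scons A TVar) (scons B TVar) f sigma.

(** ** The type mu alpha. sigma(alpha)

    [sigma] has the single type variable 0, so the types and terms below are
    closed and need no shifting; under the binder of alpha, sigma(alpha) is
    [sigma] itself. *)

Definition mu (sigma : ty) : ty := TPi (TArr (TLolli sigma (TVar 0)) (TVar 0)).

Definition fold_tm (sigma : ty) : tm :=
  TLam (LamI (TLolli sigma (TVar 0))
    (Lam (mu sigma) (App (TApp (Var 0) (TVar 0)) (Bang (Var 1))))).

Definition in_tm (sigma : ty) : tm :=
  Lam (ty_inst (mu sigma) sigma)
    (TLam (LamI (TLolli sigma (TVar 0))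
       (App (Var 0)
          (App (functor_act sigma (mu sigma) (TVar 0)
                  (App (TApp (fold_tm sigma) (TVar 0)) (Bang (Var 0))))
               (Var 1))))).

(* Main.v *)
Require Import Defs.
From Stdlib Require List.
From mathcomp Require Import all_boot.
From Stdlib Require Import FunctionalExtensionality.

Set Implicit Arguments.
Unset Strict Implicit.
Unset Printing Implicit Defensive.

(** Identity extension for the closed type [mu] makes every [x : mu] related to
    itself by [mu[]]; instantiated at [R] and [in], which preserves [R], this gives
    [R(x mu !in, x mu !in)], and it remains to see that [x mu !in = x]. By
    extensionality and parametricity of [!] this reduces to
    [fold a !f (x mu !in) = x a !f], which is parametricity of [x] at the graph of
    [h = fold a !f], provided that [sigma[graph h](z, z')] implies
    [sigma(h) z = z']. The latter is parametricity of the functorial action, applied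
    to the pair [(h, id)], which maps [graph h] to [eq], together with the functor
    law [sigma(id) = id], which holds up to external equality. *)

(** * Substitution calculus *)

(** Extensionality meets an obstacle at [!]: an equation between maps out of [!T] has to be shown at
    every argument of type [!T], and such an argument need not be a value [!f]. The impredicative
    relation on [!T] repairs this, since self-relatedness of an argument, which identity extension
    supplies, acts as an induction principle that reduces to values.

    The inclusion of sigma[graph h] in the graph of sigma(h) is obtained without a case analysis on
    [sigma]: the functorial action is packed into a single polymorphic term, and identity extension
    for the type of that term treats all constructors at once. Structural induction is left for the
    syntactic facts about the action, namely substitution, typing and sigma(id) = id. The pair (h,
    id) is chosen because its second half turns the action at the target into sigma(id), so that the
    target element z' itself comes out. *)

Lemma upn_id : upn id = id.
Proof. by apply: functional_extensionality; case. Qed.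

Lemma up_ty_id : up_ty TVar = TVar.
Proof. by apply: functional_extensionality; case. Qed.

Lemma up_ty_upn (s : nat -> ty) (r : nat -> nat) : up_ty s \o upn r = up_ty (s \o r).
Proof. by apply: functional_extensionality; case. Qed.

Lemma up_ty_var (r : nat -> nat) : up_ty (TVar \o r) = TVar \o upn r.
Proof. by apply: functional_extensionality; case. Qed.

Lemma ty_sub_id (A : ty) : ty_sub TVar A = A.
Proof. by elim: A => //= [A -> B ->|A -> B ->|A ->|A]; rewrite ?up_ty_id // => ->. Qed.

(** The fusion laws for types, terms and relations follow one order: substitution after renaming,
    renaming as substitution, renaming after substitution, and finally composition of substitutions.
    Each law under a binder uses the earlier ones for the lifted substitution. *)
Lemma ty_sub_ren (A : ty) s r : ty_sub s (ty_ren r A) = ty_sub (s \o r) A.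
Proof.
by elim: A s r => //= [A IA B IB|A IA B IB|A IA|A IA] s r;
  rewrite ?IA ?IB // up_ty_upn.
Qed.

Lemma ty_ren_sub_var (A : ty) r : ty_ren r A = ty_sub (TVar \o r) A.
Proof.
by elim: A r => //= [A IA B IB|A IA B IB|A IA|A IA] r;
  rewrite ?IA ?IB // up_ty_var.
Qed.

Lemma ty_ren_ren (A : ty) r r' : ty_ren r (ty_ren r' A) = ty_ren (r \o r') A.
Proof. by rewrite [LHS]ty_ren_sub_var ty_sub_ren ty_ren_sub_var. Qed.

Lemma ty_ren_up (s : nat -> ty) r i :
  ty_ren (upn r) (up_ty s i) = up_ty (ty_ren r \o s) i.
Proof. by case: i => //= i; rewrite !ty_ren_ren. Qed.

Lemma ty_ren_sub (A : ty) r s : ty_ren r (ty_sub s A) = ty_sub (ty_ren r \o s) A.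
Proof.
elim: A r s => //= [A IA B IB|A IA B IB|A IA|A IA] r s; rewrite ?IA ?IB //.
by congr (TPi (ty_sub _ _)); apply: functional_extensionality => i /=; rewrite ty_ren_up.
Qed.

Lemma ty_sub_up (s s' : nat -> ty) i :
  ty_sub (up_ty s) (up_ty s' i) = up_ty (ty_sub s \o s') i.
Proof. by case: i => //= i; rewrite ty_sub_ren ty_ren_sub. Qed.

Lemma ty_sub_sub (A : ty) s s' : ty_sub s (ty_sub s' A) = ty_sub (ty_sub s \o s') A.
Proof.
elim: A s s' => //= [A IA B IB|A IA B IB|A IA|A IA] s s'; rewrite ?IA ?IB //.
by congr (TPi (ty_sub _ _)); apply: functional_extensionality => i /=; rewrite ty_sub_up.
Qed.

Lemma ty_sub_wf_ext n (A : ty) s s' :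
  ty_wf n A -> (forall i, i < n -> s i = s' i) -> ty_sub s A = ty_sub s' A.
Proof.
elim: A n s s' => //= [i|A IA B IB|A IA B IB|A IA|A IA] n s s'.
- by move=> ? ->.
- by case/andP=> wA wB e; rewrite (IA n s s') // (IB n s s').
- by case/andP=> wA wB e; rewrite (IA n s s') // (IB n s s').
- by move=> wA e; rewrite (IA n s s').
- by move=> wA e; rewrite (IA n.+1 _ (up_ty s')) // => -[|i] //= /e ->.
Qed.

Lemma ty_sub_wf_id n (A : ty) s :
  ty_wf n A -> (forall i, i < n -> s i = TVar i) -> ty_sub s A = A.
Proof. by move=> w e; rewrite (ty_sub_wf_ext w e) ty_sub_id. Qed.

Lemma ty_sub_closed (A : ty) s : ty_wf 0 A -> ty_sub s A = A.
Proof. by move=> w; apply: (ty_sub_wf_id w). Qed.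

Lemma ty_ren_closed (A : ty) r : ty_wf 0 A -> ty_ren r A = A.
Proof. by move=> w; rewrite ty_ren_sub_var ty_sub_closed. Qed.

Lemma ty_wf_ren n m (A : ty) r :
  ty_wf n A -> (forall i, i < n -> r i < m) -> ty_wf m (ty_ren r A).
Proof.
elim: A n m r => //= [i|A IA B IB|A IA B IB|A IA] n m r.
- by move=> ?; apply.
- by case/andP=> wA wB e; rewrite (IA n) // (IB n).
- by case/andP=> wA wB e; rewrite (IA n) // (IB n).
- by move=> wA e; rewrite (IA n.+1) // => -[|i] //= /e.
Qed.

Lemma ty_wf_sub n m (A : ty) s :
  ty_wf n A -> (forall i, i < n -> ty_wf m (s i)) -> ty_wf m (ty_sub s A).
Proof.
elim: A n m s => //= [i|A IA B IB|A IA B IB|A IA] n m s.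
- by move=> ?; apply.
- by case/andP=> wA wB e; rewrite (IA n) // (IB n).
- by case/andP=> wA wB e; rewrite (IA n) // (IB n).
- move=> wA e; rewrite (IA n.+1) // => -[|i] //= /e w.
  exact: ty_wf_ren w _.
Qed.

Lemma ty_wf_le n m (A : ty) : n <= m -> ty_wf n A -> ty_wf m A.
Proof.
by move=> nm w; rewrite -(ty_sub_id A); apply: (ty_wf_sub w) => i /leq_trans; apply.
Qed.

Lemma ty_wf_renS n (A : ty) : ty_wf n A -> ty_wf n.+1 (ty_ren S A).
Proof. by move=> w; apply: (ty_wf_ren w). Qed.

(** * Substitution in terms *)

Definition shift_ty (e : nat -> tm) : nat -> tm := fun i => tm_shift 1 0 (e i).

Lemma up_tm_upn e r : up_tm e \o upn r = up_tm (e \o r).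
Proof. by apply: functional_extensionality; case. Qed.

Lemma up_tm_var r : up_tm (Var \o r) = Var \o upn r.
Proof. by apply: functional_extensionality; case. Qed.

Lemma up_tm_id : up_tm Var = Var.
Proof. by apply: functional_extensionality; case. Qed.

Lemma tm_sub_id t : tm_sub TVar Var t = t.
Proof.
elim: t => //= [A t IH|t IH u IHu|t IH u IHu|t ->|t IH|t -> A|t IH u IHu|t IH u IHu|t IH u IHu];
  rewrite ?up_tm_id ?ty_sub_id ?up_ty_id ?IH ?IHu //.
Qed.

Lemma tm_sub_ren t s e rt re :
  tm_sub s e (tm_ren rt re t) = tm_sub (s \o rt) (e \o re) t.
Proof.
elim: t s e rt re => //=
 [A t IH|t IH u IHu|t IH u IHu|t IH|t IH|t IH A|t IH u IHu|t IH u IHu|t IH u IHu] s e rt re;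
 rewrite ?IH ?IHu ?ty_sub_ren ?up_ty_upn ?up_tm_upn //.
Qed.

Lemma tm_ren_sub_var t rt re : tm_ren rt re t = tm_sub (TVar \o rt) (Var \o re) t.
Proof.
elim: t rt re => //=
 [A t IH|t IH u IHu|t IH u IHu|t IH|t IH|t IH A|t IH u IHu|t IH u IHu|t IH u IHu] rt re;
 rewrite ?IH ?IHu ?ty_ren_sub_var ?up_ty_var ?up_tm_var //.
Qed.

Lemma tm_ren_ren t rt re rt' re' :
  tm_ren rt re (tm_ren rt' re' t) = tm_ren (rt \o rt') (re \o re') t.
Proof. by rewrite [LHS]tm_ren_sub_var tm_sub_ren tm_ren_sub_var. Qed.

Lemma tm_ren_up rt re e :
  tm_ren rt (upn re) \o up_tm e = up_tm (tm_ren rt re \o e).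
Proof. by apply: functional_extensionality; case => //= i; rewrite /tm_shift !tm_ren_ren. Qed.

Lemma tm_ren_sub t rt re s e :
  tm_ren rt re (tm_sub s e t) = tm_sub (ty_ren rt \o s) (tm_ren rt re \o e) t.
Proof.
elim: t rt re s e => //=
 [A t IH|t IH u IHu|t IH u IHu|t IH|t IH|t IH A|t IH u IHu|t IH u IHu|t IH u IHu] rt re s e;
 rewrite ?IH ?IHu ?ty_ren_sub ?tm_ren_up //.
congr (TLam (tm_sub _ _ _)).
  by apply: functional_extensionality => i /=; rewrite ty_ren_up.
by apply: functional_extensionality => i /=; rewrite /tm_shift !tm_ren_ren.
Qed.

Lemma tm_sub_up s e e' :
  tm_sub s (up_tm e) \o up_tm e' = up_tm (tm_sub s e \o e').
Proof.
apply: functional_extensionality; case => //= i.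
rewrite /tm_shift tm_sub_ren tm_ren_sub; congr tm_sub.
by apply: functional_extensionality => j /=; rewrite -[LHS]ty_sub_id ty_ren_sub_var.
Qed.

Lemma tm_sub_sub t s e s' e' :
  tm_sub s e (tm_sub s' e' t) = tm_sub (ty_sub s \o s') (tm_sub s e \o e') t.
Proof.
elim: t s e s' e' => //=
 [A t IH|t IH u IHu|t IH u IHu|t IH|t IH|t IH A|t IH u IHu|t IH u IHu|t IH u IHu] s e s' e';
 rewrite ?IH ?IHu ?ty_sub_sub ?tm_sub_up //.
congr (TLam (tm_sub _ _ _)).
  by apply: functional_extensionality => i /=; rewrite ty_sub_up.
by apply: functional_extensionality => i /=; rewrite /tm_shift tm_sub_ren tm_ren_sub.
Qed.

(** * Substitution in propositions and relations *)

Lemma map_in_ext (X Y : Type) (f g : X -> Y) (s : seq X) :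
  (forall x, List.In x s -> f x = g x) -> map f s = map g s.
Proof.
elim: s => //= x s IH h; rewrite h; last by left.
by rewrite IH // => y sy; apply: h; right.
Qed.

(** The generated scheme gives no hypothesis on the relations listed under [RInt]. *)
Section FormInd.
Variables (P : form -> Prop) (Q : drel -> Prop).
Hypothesis hEq : forall A t u, P (PEq A t u).
Hypothesis hRel : forall r t u, Q r -> P (PRel r t u).
Hypothesis hTop : P PTop.
Hypothesis hBot : P PBot.
Hypothesis hAnd : forall F G, P F -> P G -> P (PAnd F G).
Hypothesis hOr : forall F G, P F -> P G -> P (POr F G).
Hypothesis hImp : forall F G, P F -> P G -> P (PImp F G).
Hypothesis hQTy : forall q F, P F -> P (PQTy q F).
Hypothesis hQTm : forall q A F, P F -> P (PQTm q A F).
Hypothesis hQRel : forall q a A B F, P F -> P (PQRel q a A B F).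
Hypothesis hVar : forall i, Q (RVar i).
Hypothesis hComp : forall A B F, P F -> Q (RComp A B F).
Hypothesis hInt : forall A rs, (forall r, List.In r rs -> Q r) -> Q (RInt A rs).

Fixpoint form_nested_ind F : P F :=
  match F with
  | PEq A t u => hEq A t u
  | PRel r t u => hRel t u (drel_nested_ind r)
  | PTop => hTop
  | PBot => hBot
  | PAnd F G => hAnd (form_nested_ind F) (form_nested_ind G)
  | POr F G => hOr (form_nested_ind F) (form_nested_ind G)
  | PImp F G => hImp (form_nested_ind F) (form_nested_ind G)
  | PQTy q F => hQTy q (form_nested_ind F)
  | PQTm q A F => hQTm q A (form_nested_ind F)
  | PQRel q a A B F => hQRel q a A B (form_nested_ind F)
  end
with drel_nested_ind r : Q r :=
  match r with
  | RVar i => hVar i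
  | RComp A B F => hComp A B (form_nested_ind F)
  | RInt A rs => hInt A
      ((fix all_in (rs : seq drel) : forall r, List.In r rs -> Q r :=
         match rs with
         | [::] => fun r h => match h with end
         | r0 :: rs0 => fun r h =>
             match h with
             | or_introl e => eq_ind r0 Q (drel_nested_ind r0) r e
             | or_intror h0 => all_in rs0 r h0
             end
         end) rs)
  end.

Lemma form_drel_ind : (forall F, P F) /\ (forall r, Q r).
Proof. by split; [exact: form_nested_ind|exact: drel_nested_ind]. Qed.
End FormInd.

Lemma up_rel_upn r rr : up_rel r \o upn rr = up_rel (r \o rr).
Proof. by apply: functional_extensionality; case. Qed.

Lemma up_rel_var rr : up_rel (RVar \o rr) = RVar \o upn rr.
Proof. by apply: functional_extensionality; case. Qed.

Lemma up_rel_id : up_rel RVar = RVar.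
Proof. by apply: functional_extensionality; case. Qed.

Lemma form_drel_sub_id :
  (forall F, form_sub TVar Var RVar F = F) /\ (forall R, rel_sub TVar Var RVar R = R).
Proof.
apply: form_drel_ind => //=.
- by move=> A t u; rewrite ty_sub_id !tm_sub_id.
- by move=> r t u ->; rewrite !tm_sub_id.
- by move=> F G -> ->.
- by move=> F G -> ->.
- by move=> F G -> ->.
- by move=> q F {2}<-; rewrite up_ty_id.
- by move=> q A F {2}<-; rewrite ty_sub_id up_tm_id.
- by move=> q a A B F {2}<-; rewrite !ty_sub_id up_rel_id.
- by move=> A B F {2}<-; rewrite !ty_sub_id !up_tm_id.
- by move=> A rs IH; rewrite (map_in_ext (g := id)) ?map_id.
Qed.

Lemma form_drel_sub_ren :
  (forall F s e r rt re rr,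
     form_sub s e r (form_ren rt re rr F) = form_sub (s \o rt) (e \o re) (r \o rr) F) /\
  (forall R s e r rt re rr,
     rel_sub s e r (rel_ren rt re rr R) = rel_sub (s \o rt) (e \o re) (r \o rr) R).
Proof.
apply: form_drel_ind => //=.
- by move=> A t u *; rewrite ty_sub_ren !tm_sub_ren.
- by move=> R t u IH *; rewrite IH !tm_sub_ren.
- by move=> F G IF IG *; rewrite IF IG.
- by move=> F G IF IG *; rewrite IF IG.
- by move=> F G IF IG *; rewrite IF IG.
- by move=> q F IF *; rewrite IF up_ty_upn.
- by move=> q A F IF *; rewrite IF ty_sub_ren up_tm_upn.
- by move=> q a A B F IF *; rewrite IF !ty_sub_ren up_rel_upn.
- by move=> A B F IF *; rewrite IF !ty_sub_ren !up_tm_upn.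
- move=> A rs IH s e r rt re rr; congr RInt.
  by rewrite -map_comp; apply: map_in_ext => R inR /=; rewrite IH.
Qed.

Lemma form_drel_ren_sub_var :
  (forall F rt re rr,
     form_ren rt re rr F = form_sub (TVar \o rt) (Var \o re) (RVar \o rr) F) /\
  (forall R rt re rr,
     rel_ren rt re rr R = rel_sub (TVar \o rt) (Var \o re) (RVar \o rr) R).
Proof.
apply: form_drel_ind => //=.
- by move=> A t u *; rewrite ty_ren_sub_var !tm_ren_sub_var.
- by move=> R t u IH *; rewrite IH !tm_ren_sub_var.
- by move=> F G IF IG *; rewrite IF IG.
- by move=> F G IF IG *; rewrite IF IG.
- by move=> F G IF IG *; rewrite IF IG.
- by move=> q F IF *; rewrite IF up_ty_var.
- by move=> q A F IF *; rewrite IF ty_ren_sub_var up_tm_var.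
- by move=> q a A B F IF *; rewrite IF !ty_ren_sub_var up_rel_var.
- by move=> A B F IF *; rewrite IF !ty_ren_sub_var !up_tm_var.
- move=> A rs IH rt re rr; congr RInt.
  by apply: map_in_ext => R inR /=; rewrite IH.
Qed.

Lemma rel_sub_id R : rel_sub TVar Var RVar R = R.
Proof. exact: form_drel_sub_id.2. Qed.
Lemma rel_sub_ren R s e r rt re rr :
  rel_sub s e r (rel_ren rt re rr R) = rel_sub (s \o rt) (e \o re) (r \o rr) R.
Proof. exact: form_drel_sub_ren.2. Qed.
Lemma rel_ren_sub_var R rt re rr :
  rel_ren rt re rr R = rel_sub (TVar \o rt) (Var \o re) (RVar \o rr) R.
Proof. exact: form_drel_ren_sub_var.2. Qed.

Lemma rel_ren_ren R rt re rr rt' re' rr' :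
  rel_ren rt re rr (rel_ren rt' re' rr' R) = rel_ren (rt \o rt') (re \o re') (rr \o rr') R.
Proof. by rewrite [LHS]rel_ren_sub_var rel_sub_ren rel_ren_sub_var. Qed.

Lemma rel_ren_up rt re rr r :
  rel_ren rt re (upn rr) \o up_rel r = up_rel (rel_ren rt re rr \o r).
Proof. by apply: functional_extensionality; case => //= i; rewrite /rel_shift !rel_ren_ren. Qed.

Lemma form_drel_ren_sub :
  (forall F rt re rr s e r,
     form_ren rt re rr (form_sub s e r F) =
     form_sub (ty_ren rt \o s) (tm_ren rt re \o e) (rel_ren rt re rr \o r) F) /\
  (forall R rt re rr s e r,
     rel_ren rt re rr (rel_sub s e r R) =
     rel_sub (ty_ren rt \o s) (tm_ren rt re \o e) (rel_ren rt re rr \o r) R).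
Proof.
apply: form_drel_ind => //=.
- by move=> A t u *; rewrite ty_ren_sub !tm_ren_sub.
- by move=> R t u IH *; rewrite IH !tm_ren_sub.
- by move=> F G IF IG *; rewrite IF IG.
- by move=> F G IF IG *; rewrite IF IG.
- by move=> F G IF IG *; rewrite IF IG.
- move=> q F IF *; rewrite IF; congr (PQTy _ (form_sub _ _ _ _));
    apply: functional_extensionality => i /=.
  + by rewrite ty_ren_up.
  + by rewrite /tm_shift !tm_ren_ren.
  + by rewrite /rel_shift !rel_ren_ren.
- move=> q A F IF *; rewrite IF ty_ren_sub tm_ren_up.
  congr (PQTm _ _ (form_sub _ _ _ _)); apply: functional_extensionality => i /=.
  by rewrite /rel_shift !rel_ren_ren.
- by move=> q a A B F IF *; rewrite IF !ty_ren_sub rel_ren_up.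
- move=> A B F IF *; rewrite IF !ty_ren_sub !tm_ren_up.
  congr (RComp _ _ (form_sub _ _ _ _)); apply: functional_extensionality => i /=.
  by rewrite /rel_shift !rel_ren_ren.
- move=> A rs IH *; congr RInt.
  by rewrite -map_comp; apply: map_in_ext => R inR /=; rewrite IH.
Qed.

Lemma rel_ren_sub R rt re rr s e r :
  rel_ren rt re rr (rel_sub s e r R) =
  rel_sub (ty_ren rt \o s) (tm_ren rt re \o e) (rel_ren rt re rr \o r) R.
Proof. exact: form_drel_ren_sub.2. Qed.

Lemma rel_sub_up s e r r' :
  rel_sub s e (up_rel r) \o up_rel r' = up_rel (rel_sub s e r \o r').
Proof.
apply: functional_extensionality; case => //= i.
rewrite /rel_shift rel_sub_ren rel_ren_sub; congr rel_sub;
  apply: functional_extensionality => j /=.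
- by rewrite -[LHS]ty_sub_id ty_ren_sub_var.
- by rewrite -[LHS]tm_sub_id tm_ren_sub_var.
Qed.

Lemma form_drel_sub_sub :
  (forall F s e r s' e' r',
     form_sub s e r (form_sub s' e' r' F) =
     form_sub (ty_sub s \o s') (tm_sub s e \o e') (rel_sub s e r \o r') F) /\
  (forall R s e r s' e' r',
     rel_sub s e r (rel_sub s' e' r' R) =
     rel_sub (ty_sub s \o s') (tm_sub s e \o e') (rel_sub s e r \o r') R).
Proof.
(* Relations are weakened by term variables alone under a term binder, which leaves a trivial
   renaming of the types. *)
have tyid (s : nat -> ty) : ty_ren (addn 0) \o s = s.
  by apply: functional_extensionality => j /=; rewrite -[RHS]ty_sub_id ty_ren_sub_var.
apply: form_drel_ind => //=.
- by move=> A t u *; rewrite ty_sub_sub !tm_sub_sub.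
- by move=> R t u IH *; rewrite IH !tm_sub_sub.
- by move=> F G IF IG *; rewrite IF IG.
- by move=> F G IF IG *; rewrite IF IG.
- by move=> F G IF IG *; rewrite IF IG.
- move=> q F IF *; rewrite IF; congr (PQTy _ (form_sub _ _ _ _));
    apply: functional_extensionality => i /=.
  + by rewrite ty_sub_up.
  + by rewrite /tm_shift tm_sub_ren tm_ren_sub.
  + by rewrite /rel_shift rel_sub_ren rel_ren_sub.
- move=> q A F IF *; rewrite IF ty_sub_sub tm_sub_up.
  congr (PQTm _ _ (form_sub _ _ _ _)); apply: functional_extensionality => i /=.
  by rewrite /rel_shift rel_sub_ren rel_ren_sub tyid.
- by move=> q a A B F IF *; rewrite IF !ty_sub_sub rel_sub_up.
- move=> A B F IF s e r s' e' r'; rewrite IF !ty_sub_sub !tm_sub_up.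
  congr (RComp _ _ (form_sub _ _ _ _)); apply: functional_extensionality => i /=.
  rewrite /rel_shift rel_sub_ren rel_ren_sub tyid; congr rel_sub.
  by apply: functional_extensionality => j /=; rewrite /tm_shift tm_ren_ren.
- move=> A rs IH *; congr RInt.
  by rewrite -map_comp; apply: map_in_ext => R inR /=; rewrite IH.
Qed.

Lemma form_sub_sub F s e r s' e' r' :
  form_sub s e r (form_sub s' e' r' F) =
  form_sub (ty_sub s \o s') (tm_sub s e \o e') (rel_sub s e r \o r') F.
Proof. exact: form_drel_sub_sub.1. Qed.
Lemma rel_sub_sub R s e r s' e' r' :
  rel_sub s e r (rel_sub s' e' r' R) =
  rel_sub (ty_sub s \o s') (tm_sub s e \o e') (rel_sub s e r \o r') R.
Proof. exact: form_drel_sub_sub.2. Qed.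

(** * Typing and external equality *)

Lemma hyp_split_no_linear G : no_linear G -> hyp_split G G G.
Proof. by elim: G => [|[A|A|] G IH] //= => [_|/IH|/IH]; constructor. Qed.

Lemma hyp_split_map r G G1 G2 :
  hyp_split G G1 G2 ->
  hyp_split (map (hyp_ren r) G) (map (hyp_ren r) G1) (map (hyp_ren r) G2).
Proof. by elim=> /= *; constructor. Qed.

Lemma no_linear_map r G : no_linear (map (hyp_ren r) G) = no_linear G.
Proof. by rewrite /no_linear all_map; apply: eq_all; case. Qed.

(** Weakening in the middle of a context, as required to pass under binders. If the context is
    shorter than [k], the block goes to its end. *)
Fixpoint ins (hs : seq hyp) (k : nat) (G : seq hyp) : seq hyp :=
  match k, G with
  | k'.+1, h :: G' => h :: ins hs k' G'
  | _, _ => hs ++ G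
  end.

Lemma hyp_split_ins hs k G G1 G2 :
  no_linear hs -> hyp_split G G1 G2 -> hyp_split (ins hs k G) (ins hs k G1) (ins hs k G2).
Proof.
move=> nl sp.
have cat0 Ga Gb Gc : hyp_split Ga Gb Gc -> hyp_split (hs ++ Ga) (hs ++ Gb) (hs ++ Gc).
  by elim: hs nl => //= -[A|A|] hs IH //= nl sp'; constructor; apply: IH.
elim: k G G1 G2 sp => [|k IH] G G1 G2 sp; first exact: cat0.
by case: sp => [|A|||] * /=; first apply: cat0; constructor; apply: IH.
Qed.

Lemma no_linear_ins hs k G : no_linear hs -> no_linear G -> no_linear (ins hs k G).
Proof.
rewrite /no_linear => nl.
elim: k G => [|k IH] [|h G] /=; rewrite ?all_cat ?nl //.
by case/andP=> -> /IH.
Qed.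

Lemma ins_var hs k G i h :
  onth G i = Some h ->
  onth (ins hs k G) (iter k upn (addn (size hs)) i) = Some h /\
  (no_linear hs -> no_linear (set_nth Off G i Off) ->
   no_linear (set_nth Off (ins hs k G) (iter k upn (addn (size hs)) i) Off)).
Proof.
elim: k G i => [|k IH] G i /=.
  move=> e; split.
    by elim: hs => //= x hs.
  by elim: hs => //= x hs IHs /andP[/= -> /IHs nl /nl].
case: G i => [|x G] [|i] //=.
  by move=> e; split=> // nl; apply: no_linear_ins.
by move=> /IH [e nl]; split=> //= nlh /andP[-> /=]; apply: nl.
Qed.

Lemma map_ins f hs k G : map f (ins hs k G) = ins (map f hs) k (map f G).
Proof. by elim: k G => [|k IH] [|h G] //=; rewrite ?map_cat ?IH. Qed.

Lemma hyp_ren_comp r r' : hyp_ren r \o hyp_ren r' =1 hyp_ren (r \o r').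
Proof. by case=> //= A; rewrite ty_ren_ren. Qed.

Lemma ty_ren_id (A : ty) : ty_ren id A = A.
Proof. by rewrite ty_ren_sub_var ty_sub_id. Qed.

(** The block may contain [Off] entries besides intuitionistic ones. These are what a term sees when
    it is shifted below linear binders whose variables belong to other subterms, as in [LamI] and
    [fun_act]. *)
Lemma has_type_ins n G t A hs k :
  has_type n G t A -> no_linear hs ->
  has_type n (ins hs k G) (tm_ren id (iter k upn (addn (size hs))) t) A.
Proof.
move=> ht; elim: ht hs k => /=.
- move=> {}n {}G i {}A e nl hs k nlh.
  by apply: ht_int; [exact: (ins_var hs k e).1|exact: no_linear_ins].
- move=> {}n {}G i {}A e nl hs k nlh.
  by apply: ht_lin; [exact: (ins_var hs k e).1|exact: (ins_var hs k e).2].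
- by move=> *; apply: ht_star; apply: no_linear_ins.
- by move=> *; apply: ht_Y; apply: no_linear_ins.
- move=> {}n {}G {}A B {}t w _ IH hs k nlh; rewrite ty_ren_id.
  by apply: ht_lam => //; apply: (IH hs k.+1).
- move=> *; apply: ht_app; last 2 first; eauto.
  exact: hyp_split_ins.
- move=> *; apply: ht_tens; last 2 first; eauto.
  exact: hyp_split_ins.
- move=> *; apply: ht_bang; last by eauto.
  exact: no_linear_ins.
- move=> {}n {}G {}A {}t _ IH hs k nlh; rewrite upn_id.
  apply: ht_tlam; rewrite map_ins -(size_map (hyp_ren S)).
  by apply: IH; rewrite no_linear_map.
- move=> *; rewrite ty_ren_id; apply: ht_tapp => //; eauto.
- move=> {}n {}G G1 G2 {}A B C' s {}t sp _ IH1 _ IH2 hs k nlh.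
  apply: (ht_lett (hyp_split_ins k nlh sp)); [exact: IH1|exact: (IH2 hs k.+2)].
- move=> {}n {}G G1 G2 {}A C' s {}t sp _ IH1 _ IH2 hs k nlh.
  apply: (ht_letb (hyp_split_ins k nlh sp)); [exact: IH1|exact: (IH2 hs k.+1)].
- move=> {}n {}G G1 G2 C' s {}t sp _ IH1 _ IH2 hs k nlh.
  apply: (ht_lets (hyp_split_ins k nlh sp)); [exact: IH1|exact: IH2].
Qed.

Lemma has_type_shift n G t A hs :
  has_type n G t A -> no_linear hs ->
  has_type n (hs ++ G) (tm_shift 0 (size hs) t) A.
Proof. by move=> ht nl; have := has_type_ins 0 ht nl; case: G {ht}. Qed.

Lemma ty_sub_ren_inst (A B : ty) s :
  ty_sub s (ty_inst B A) = ty_inst (ty_sub s B) (ty_sub (up_ty s) A).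
Proof.
rewrite /ty_inst !ty_sub_sub; congr ty_sub; apply: functional_extensionality.
by case=> //= i; rewrite ty_sub_ren ty_sub_id.
Qed.

Lemma ty_ren_inst (A B : ty) r :
  ty_ren r (ty_inst B A) = ty_inst (ty_ren r B) (ty_ren (upn r) A).
Proof. by rewrite !(ty_ren_sub_var _ r) ty_sub_ren_inst up_ty_var -!ty_ren_sub_var. Qed.

Lemma no_linear_set_nth_map r G i h :
  onth G i = Some h -> no_linear (set_nth Off (map (hyp_ren r) G) i Off) =
  no_linear (set_nth Off G i Off).
Proof.
elim: G i => [|x G IH] [|i] //=; first by rewrite no_linear_map.
by move=> /IH ->; case: x.
Qed.

Lemma has_type_ren_ty n G t A m r :
  has_type n G t A -> (forall i, i < n -> r i < m) ->
  has_type m (map (hyp_ren r) G) (tm_ren r id t) (ty_ren r A).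
Proof.
move=> ht; elim: ht m r => /=.
- move=> {}n {}G i {}A e nl m r h.
  by apply: ht_int; rewrite ?no_linear_map // onth_map e.
- move=> {}n {}G i {}A e nl m r h; apply: ht_lin; first by rewrite onth_map e.
  by rewrite (no_linear_set_nth_map _ e).
- by move=> *; apply: ht_star; rewrite no_linear_map.
- by move=> *; apply: ht_Y; rewrite no_linear_map.
- move=> {}n {}G {}A B {}t w _ IH m r h; rewrite upn_id.
  by apply: ht_lam; [exact: ty_wf_ren w h|exact: IH].
- by move=> {}n {}G G1 G2 {}A B {}t u sp _ IH1 _ IH2 m r h;
    apply: ht_app (hyp_split_map r sp) (IH1 _ _ h) (IH2 _ _ h).
- by move=> {}n {}G G1 G2 {}A B {}t u sp _ IH1 _ IH2 m r h;
    apply: ht_tens (hyp_split_map r sp) (IH1 _ _ h) (IH2 _ _ h).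
- by move=> {}n {}G {}A {}t nl _ IH m r h; apply: ht_bang; rewrite ?no_linear_map //; apply: IH.
- move=> {}n {}G {}A {}t _ IH m r h; apply: ht_tlam.
  rewrite -map_comp (eq_map (hyp_ren_comp S r)) -[S \o r]/(upn r \o S).
  rewrite -(eq_map (hyp_ren_comp (upn r) S)) map_comp.
  by apply: IH => -[|i] //= /h.
- move=> {}n {}G {}A B {}t w _ IH m r h; rewrite ty_ren_inst.
  by apply: ht_tapp; [exact: ty_wf_ren w h|exact: IH].
- move=> {}n {}G G1 G2 {}A B C' s {}t sp _ IH1 _ IH2 m r h; rewrite !upn_id.
  exact: ht_lett (hyp_split_map r sp) (IH1 _ _ h) (IH2 _ _ h).
- move=> {}n {}G G1 G2 {}A C' s {}t sp _ IH1 _ IH2 m r h; rewrite !upn_id.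
  exact: ht_letb (hyp_split_map r sp) (IH1 _ _ h) (IH2 _ _ h).
- move=> {}n {}G G1 G2 C' s {}t sp _ IH1 _ IH2 m r h.
  exact: ht_lets (hyp_split_map r sp) (IH1 _ _ h) (IH2 _ _ h).
Qed.

(** Gives every linear variable to the second half. It serves let-terms whose first part consumes
    only a newly bound variable, the rest of the context going to the body. *)
Lemma hyp_split_offs G : exists2 G0, no_linear G0 & hyp_split G G0 G.
Proof.
elim: G => [|[A|A|] G [G0 nl sp]]; first by exists [::]; [|constructor].
- by exists (Int A :: G0) => //; constructor.
- by exists (Off :: G0) => //; apply: hyp_split_r.
- by exists (Off :: G0) => //; constructor.
Qed.

Lemma has_type_LamI n G A B t :
  ty_wf n A -> has_type n (Int A :: G) t B -> has_type n G (LamI A t) (TArr A B).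
Proof.
move=> w ht; apply: ht_lam => //; have [G0 nl sp] := hyp_split_offs G.
apply: (@ht_letb _ _ (Lin (TBang A) :: G0) (Off :: G) A).
- by constructor.
- exact: ht_lin.
(* The variable of type [!A] bound by [Lam] lies just below variable 0 and has been consumed by the
   let, hence an [Off] inserted at depth 1. *)
- exact: (has_type_ins (hs := [:: Off]) 1 ht).
Qed.

(** Allows [LamI] to stay folded in later computations, which hides the shift in its body. *)
Lemma tm_sub_LamI A t s e : tm_sub s e (LamI A t) = LamI (ty_sub s A) (tm_sub s (up_tm e) t).
Proof.
rewrite /LamI /=; congr (Lam _ (LetB _ _)).
rewrite tm_sub_ren tm_ren_sub; congr tm_sub; apply: functional_extensionality => i /=.
  by rewrite ty_ren_id.
by case: i => //= i; rewrite /tm_shift !tm_ren_ren.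
Qed.

Lemma teq_beta_LamI n G A B t u :
  no_linear G -> ty_wf n A -> has_type n (Int A :: G) t B -> has_type n G u A ->
  teq n G (App (LamI A t) (Bang u)) (tm_inst u t) B.
Proof.
move=> nl w ht hu; have sp := hyp_split_no_linear nl.
have hbu : has_type n G (Bang u) (TBang A) by apply: ht_bang.
(* The linear beta-step cancels the shift made by [LamI] and leaves a redex of the let for [!] with
   the original body. *)
have e : tm_inst (Bang u) (LetB (Var 0) (tm_ren id (upn S) t)) = LetB (Bang u) t.
  rewrite /tm_inst /= tm_sub_ren -[in RHS](tm_sub_id t); congr (LetB _ (tm_sub _ _ _)).
  by apply: functional_extensionality => -[|i].
apply: teq_trans.
  by apply: teq_beta_lam; apply: ht_app sp _ hbu; apply: has_type_LamI.
by rewrite e; apply: teq_beta_bang; apply: ht_letb sp hbu ht.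
Qed.

(** * The functorial action of a type *)

Lemma has_type_id n G A : ty_wf n A -> no_linear G -> has_type n G (Lam A (Var 0)) (TLolli A A).
Proof. by move=> w nl; apply: ht_lam => //; apply: ht_lin. Qed.

(** [fun_act] tests closedness before it inspects the constructor, so the inductions on it split on
    [ty_wf 0] first. *)
Lemma fun_act_closed k s s' f A : ty_wf 0 A -> fun_act k s s' f A = Lam A (Var 0).
Proof. by case: A => //= [A B|A B|A|A] ->. Qed.

Lemma tm_sub_shift s e b t :
  tm_sub s (iter b up_tm e) (tm_shift 0 b t) = tm_shift 0 b (tm_sub s e t).
Proof.
rewrite /tm_shift tm_sub_ren tm_ren_sub; congr tm_sub.
  by apply: functional_extensionality => i /=; rewrite ty_ren_id.
apply: functional_extensionality => i /=.
elim: b i => [|b IH] i /=; first by rewrite tm_ren_sub_var tm_sub_id.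
by rewrite IH /tm_shift tm_ren_ren.
Qed.

Lemma tm_sub_shift_ty s e t :
  tm_sub (up_ty s) (shift_ty e) (tm_shift 1 0 t) = tm_shift 1 0 (tm_sub s e t).
Proof. by rewrite /tm_shift tm_sub_ren tm_ren_sub. Qed.

Lemma tm_shift11 t : tm_shift 1 1 t = tm_shift 1 0 (tm_shift 0 1 t).
Proof. by rewrite /tm_shift tm_ren_ren. Qed.

(** The variables of [A] are interpreted through [s] and [s'], so an outer substitution reaches
    these and [f] but leaves [A] alone. *)
Lemma fun_act_sub k s s' f A s0 e0 :
  tm_sub s0 e0 (fun_act k s s' f A) =
  fun_act k (ty_sub s0 \o s) (ty_sub s0 \o s') (tm_sub s0 e0 f) A.
Proof.
have up s1 s2 : ty_sub (up_ty s1) \o up_ty s2 = up_ty (ty_sub s1 \o s2).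
  by apply: functional_extensionality => i /=; rewrite ty_sub_up.
elim: A k s s' f s0 e0 => [i||A IA B IB|A IA B IB|A IA|A IA] k s s' f s0 e0 //=.
- by case: eqP.
- case: ifP => [/andP[wA wB]|_] /=; first by rewrite !ty_sub_closed.
  rewrite IA IB !ty_sub_sub.
  by rewrite !(tm_sub_shift s0 e0 3).
- case: ifP => [/andP[wA wB]|_] /=; first by rewrite !ty_sub_closed.
  rewrite IA IB !ty_sub_sub.
  by rewrite !(tm_sub_shift s0 e0 2).
- case: ifP => [wA|_] /=; first by rewrite ty_sub_closed.
  rewrite IA !ty_sub_sub.
  by rewrite !(tm_sub_shift s0 e0 2).
- case: ifP => [wA|_] /=; first by rewrite -[TPi (ty_sub _ _)]/(ty_sub s0 (TPi A)) ty_sub_closed.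
  rewrite IA !up tm_shift11 (@tm_sub_shift_ty s0 (up_tm e0)).
  by rewrite (tm_sub_shift s0 e0 1) ty_sub_sub up -tm_shift11.
Qed.

Lemma fun_act_wf_ext m k s1 s1' s2 s2' f A :
  ty_wf m A -> (forall i, i < m -> s1 i = s2 i) -> (forall i, i < m -> s1' i = s2' i) ->
  fun_act k s1 s1' f A = fun_act k s2 s2' f A.
Proof.
elim: A m k s1 s1' s2 s2' f => [i||A IA B IB|A IA B IB|A IA|A IA] m k s1 s1' s2 s2' f //=.
- by move=> im e _; rewrite e.
- case/andP=> wA wB e e'; rewrite !(ty_sub_wf_ext (A := _) _ e) //.
  by rewrite (IA m _ _ _ s2 s2') // (IB m _ _ _ s2 s2').
- case/andP=> wA wB e e'.
  rewrite (IA m _ _ _ s2' s2) // (IB m _ _ _ s2 s2') //.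
  by rewrite (ty_sub_wf_ext wA e) (ty_sub_wf_ext wB e) (ty_sub_wf_ext wA e').
- by move=> wA e e'; rewrite (IA m _ _ _ s2 s2') // (ty_sub_wf_ext wA e).
- move=> wA e e'.
  have up s s' : (forall i, i < m -> s i = s' i) ->
      forall i, i < m.+1 -> up_ty s i = up_ty s' i.
    by move=> h [|i] //= /h ->.
  by rewrite (IA m.+1 _ _ _ (up_ty s2) (up_ty s2')) ?(ty_sub_wf_ext wA (up _ _ e)) //; apply: up.
Qed.

(** The left side of a lolli swaps [s] and [s'], so the induction carries a polarity [p] that
    decides the direction of [f]. Agreement of [s] and [s'] away from [k] is what types the identity
    at the other variables. *)
Lemma fun_act_typed p k s s' f A n m G :
  ty_wf m A -> (forall i, i < m -> ty_wf n (s i)) -> (forall i, i < m -> ty_wf n (s' i)) ->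
  (forall i, i < m -> i != k -> s i = s' i) -> occurs_only p k A -> no_linear G ->
  has_type n G f (if p then TLolli (s k) (s' k) else TLolli (s' k) (s k)) ->
  has_type n G (fun_act k s s' f A) (TLolli (ty_sub s A) (ty_sub s' A)).
Proof.
elim: A p k s s' f n m G => [i||A IA B IB|A IA B IB|A IA|A IA] p k s s' f n m G.
(* An occurrence of [k] itself forces [p] to be true. *)
- move=> /= im w w' e; case: eqP => [->|/eqP ik] /=; first by move=> -> _.
  by rewrite -(e i im ik) => *; apply: has_type_id => //; apply: w.
- by move=> *; apply: has_type_id.
- move=> wf w w' e oc nl hf.
  have [wc|nc] := boolP (ty_wf 0 (TTens A B)).
    by rewrite fun_act_closed // !(ty_sub_closed _ wc); apply: has_type_id;
      rewrite ?(ty_wf_le _ wc).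
  have wT := ty_wf_sub wf w.
  move: wf oc nc => /= /andP[wA wB] /andP[oA oB] /negbTE ->.
  apply: ht_lam => //.
  apply: (@ht_lett _ _ (Lin (ty_sub s (TTens A B)) :: G) (Off :: G)).
  + by constructor; apply: hyp_split_no_linear.
  + exact: ht_lin.
  + have sp := hyp_split_no_linear nl.
    (* The three leading positions are the second component, the first component, and the pair,
       which the let has consumed. *)
    apply: (@ht_tens _ _ [:: Off, Lin (ty_sub s A), Off & G] [:: Lin (ty_sub s B), Off, Off & G]).
      by do 3 constructor.
    apply: (@ht_app _ _ [:: Off, Off, Off & G] [:: Off, Lin (ty_sub s A), Off & G] (ty_sub s A)).
      by do 3 constructor.
    apply: (IA p _ _ _ _ _ m) => //; exact: (has_type_shift (hs := [:: Off; Off; Off])).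
    exact: ht_lin.
    apply: (@ht_app _ _ [:: Off, Off, Off & G] [:: Lin (ty_sub s B), Off, Off & G] (ty_sub s B)).
      by do 3 constructor.
    apply: (IB p _ _ _ _ _ m) => //; exact: (has_type_shift (hs := [:: Off; Off; Off])).
    exact: ht_lin.
- move=> wf w w' e oc nl hf.
  have [wc|nc] := boolP (ty_wf 0 (TLolli A B)).
    by rewrite fun_act_closed // !(ty_sub_closed _ wc); apply: has_type_id;
      rewrite ?(ty_wf_le _ wc).
  have wT := ty_wf_sub wf w.
  move: wf oc nc => /= /andP[wA wB] /andP[oA oB] /negbTE ->.
  have sp := hyp_split_no_linear nl.
  apply: ht_lam => //; apply: ht_lam; first exact: ty_wf_sub wA w'.
  have e' i : i < m -> i != k -> s' i = s i by move=> im ik; rewrite e.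
  apply: (@ht_app _ _ [:: Off, Off & G] _ (ty_sub s B)); first by apply: hyp_split_r;
    apply: hyp_split_r; eassumption.
    apply: (IB p _ _ _ _ _ m) => //; exact: (has_type_shift (hs := [:: Off; Off])).
  apply: (@ht_app _ _ [:: Off, Lin (TLolli (ty_sub s A) (ty_sub s B)) & G] [:: Lin (ty_sub s'
    A), Off & G] (ty_sub s A)).
  + by do 2 constructor.
  + exact: ht_lin.
  apply: (@ht_app _ _ [:: Off, Off & G] [:: Lin (ty_sub s' A), Off & G] (ty_sub s' A)).
  + by do 2 constructor.
  + apply: (IA (~~ p) _ _ _ _ _ m) => //; rewrite if_neg;
      exact: (has_type_shift (hs := [:: Off; Off])).
  + exact: ht_lin.
- move=> wf w w' e oc nl hf.
  have [wc|nc] := boolP (ty_wf 0 (TBang A)).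
    by rewrite fun_act_closed // !(ty_sub_closed _ wc); apply: has_type_id;
      rewrite ?(ty_wf_le _ wc).
  have wT := ty_wf_sub wf w.
  move: wf oc nc => /= wA oA /negbTE ->.
  have sp := hyp_split_no_linear nl.
  apply: ht_lam => //.
  apply: (@ht_letb _ _ (Lin (ty_sub s (TBang A)) :: G) (Off :: G)).
  + by constructor.
  + exact: ht_lin.
  apply: ht_bang => //.
  apply: (@ht_app _ _ [:: Int (ty_sub s A), Off & G] [:: Int (ty_sub s A), Off & G] (ty_sub s A)).
  + by do 2 constructor.
  + apply: (IA p _ _ _ _ _ m) => //; exact: (has_type_shift (hs := [:: Int _; Off])).
  + exact: ht_int.
- move=> wf w w' e oc nl hf.
  have [wc|nc] := boolP (ty_wf 0 (TPi A)).
    by rewrite fun_act_closed // !(ty_sub_closed _ wc); apply: has_type_id;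
      rewrite ?(ty_wf_le _ wc).
  have wT := ty_wf_sub wf w.
  move: wf oc nc => /= wA oA /negbTE ->.
  have sp := hyp_split_no_linear nl.
  apply: ht_lam => //; apply: ht_tlam => /=.
  have nl' : no_linear (map (hyp_ren S) G) by rewrite no_linear_map.
  have sp' := hyp_split_no_linear nl'.
  apply: (@ht_app _ _ (Off :: map (hyp_ren S) G) _ (ty_sub (up_ty s) A)).
  + by apply: hyp_split_r; eassumption.
  + apply: (IA p _ _ _ _ _ m.+1) => //.
    * by move=> [|i] //= /w ?; apply: ty_wf_renS.
    * by move=> [|i] //= /w' ?; apply: ty_wf_renS.
    * by move=> [|i] //= im ik; rewrite e.
    * have := has_type_shift (hs := [:: Off]) (has_type_ren_ty (m := n.+1) (r := S) hf (fun i
        => id)) isT.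
      rewrite tm_shift11 /tm_shift tm_ren_ren /= tm_ren_ren.
      by case: (p).
  (* Instantiating the shifted [TPi] at the freshly bound type variable gives back the original
     body. *)
  + set G2 := (_ :: _).
    have := @ht_tapp n.+1 G2 (ty_ren (upn S) (ty_sub (up_ty s) A)) (TVar 0) (Var 0) isT.
    rewrite /ty_inst ty_sub_ren (_ : scons _ _ \o _ = TVar) ?ty_sub_id; first by apply;
      apply: ht_lin.
    by apply: functional_extensionality; case.
Qed.

Lemma teq_id_app n G G1 G2 F A u :
  hyp_split G G1 G2 -> ty_wf n A -> no_linear G1 ->
  teq n G1 F (Lam A (Var 0)) (TLolli A A) -> has_type n G2 u A ->
  teq n G (App F u) u A.
Proof.
move=> sp w nl eF hu.
apply: teq_trans (teq_app sp eF (teq_refl hu)) _.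
by apply: teq_beta_lam; apply: ht_app sp (has_type_id w nl) hu.
Qed.

Lemma tm_shift_id_fun b A : tm_shift 0 b (Lam A (Var 0)) = Lam A (Var 0).
Proof. by rewrite /tm_shift /= ty_ren_id. Qed.

(** Here both substitutions coincide, so swapping them on the left of a lolli changes nothing and
    both polarities are treated alike. Once the recursive actions have become identities, each
    constructor closes by its eta-rule. *)
Lemma fun_act_id k s A n m G :
  ty_wf m A -> (forall i, i < m -> ty_wf n (s i)) -> no_linear G ->
  teq n G (fun_act k s s (Lam (s k) (Var 0)) A) (Lam (ty_sub s A) (Var 0))
          (TLolli (ty_sub s A) (ty_sub s A)).
Proof.
elim: A k s n m G => [i||A IA B IB|A IA B IB|A IA|A IA] k s n m G wf w nl;
  have wT := ty_wf_sub wf w.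
- by rewrite /=; case: eqP => [<-|_]; apply: teq_refl; apply: has_type_id.
- by apply: teq_refl; apply: has_type_id.
- have [wc|nc] := boolP (ty_wf 0 (TTens A B)).
    by rewrite fun_act_closed // (ty_sub_closed s wc); apply: teq_refl; apply: has_type_id;
      rewrite ?(ty_wf_le _ wc).
  move: wf nc => /= /andP[wA wB] /negbTE ->; rewrite tm_shift_id_fun.
  apply: teq_lam => //.
  have sp := hyp_split_no_linear nl.
  set T := TTens _ _; have hv : has_type n (Lin T :: G) (Var 0) T by apply: ht_lin.
  apply: teq_trans (teq_eta_tens hv).
  apply: (@teq_lett _ _ (Lin T :: G) (Off :: G) (ty_sub s A) (ty_sub s B));
    [exact: hyp_split_l|by apply: teq_refl|].
  apply: (@teq_tens _ _ [:: Off, Lin (ty_sub s A), Off & G] [:: Lin (ty_sub s B), Off, Off & G]).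
  + by do 3 constructor.
  + apply: (@teq_id_app _ _ [:: Off, Off, Off & G] [:: Off, Lin (ty_sub s A), Off & G]) => //.
    * by do 3 constructor.
    * exact: ty_wf_sub wA w.
    * exact: IA wA w _.
    * exact: ht_lin.
  + apply: (@teq_id_app _ _ [:: Off, Off, Off & G] [:: Lin (ty_sub s B), Off, Off & G]) => //.
    * by do 3 constructor.
    * exact: ty_wf_sub wB w.
    * exact: IB wB w _.
    * exact: ht_lin.
- have [wc|nc] := boolP (ty_wf 0 (TLolli A B)).
    by rewrite fun_act_closed // (ty_sub_closed s wc); apply: teq_refl; apply: has_type_id;
      rewrite ?(ty_wf_le _ wc).
  move: wf nc => /= /andP[wA wB] /negbTE ->; rewrite tm_shift_id_fun.
  apply: teq_lam => //.
  have sp := hyp_split_no_linear nl.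
  set T := TLolli _ _; have hv : has_type n (Lin T :: G) (Var 0) T by apply: ht_lin.
  have wA' := ty_wf_sub wA w.
  apply: teq_trans (teq_eta_lam wA' hv); apply: teq_lam => //.
  have h2 : has_type n [:: Lin (ty_sub s A), Lin T & G] (App (Var 1) (Var 0)) (ty_sub s B).
    apply: (@ht_app _ _ [:: Off, Lin T & G] [:: Lin (ty_sub s A), Off & G] (ty_sub s A)).
    * by do 2 constructor.
    * exact: ht_lin.
    * exact: ht_lin.
  (* The action on the argument is contracted first; the identity on the result remains and is
     removed afterwards. *)
  apply: (@teq_trans _ _ _ (App (Lam (ty_sub s B) (Var 0)) (App (Var 1) (Var 0)))).
    apply: (@teq_app _ _ [:: Off, Off & G] [:: Lin (ty_sub s A), Lin T & G] (ty_sub s B)).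
    * by do 2 constructor.
    * exact: IB wB w _.
    * apply: (@teq_app _ _ [:: Off, Lin T & G] [:: Lin (ty_sub s A), Off & G] (ty_sub s A)).
      - by do 2 constructor.
      - by apply: teq_refl; apply: ht_lin.
      - apply: (@teq_id_app _ _ [:: Off, Off & G] [:: Lin (ty_sub s A), Off & G]) => //.
        + by do 2 constructor.
        + exact: IA wA w _.
        + exact: ht_lin.
  apply: (@teq_id_app _ _ [:: Off, Off & G] [:: Lin (ty_sub s A), Lin T & G]) => //.
  + by do 2 constructor.
  + exact: ty_wf_sub wB w.
  + by apply: teq_refl; apply: has_type_id => //; apply: ty_wf_sub wB w.
- have [wc|nc] := boolP (ty_wf 0 (TBang A)).
    by rewrite fun_act_closed // (ty_sub_closed s wc); apply: teq_refl; apply: has_type_id;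
      rewrite ?(ty_wf_le _ wc).
  move: wf nc => /= wA /negbTE ->; rewrite tm_shift_id_fun.
  apply: teq_lam => //.
  have sp := hyp_split_no_linear nl.
  set T := TBang _; have hv : has_type n (Lin T :: G) (Var 0) T by apply: ht_lin.
  apply: teq_trans (teq_eta_bang hv).
  apply: (@teq_letb _ _ (Lin T :: G) (Off :: G) (ty_sub s A));
    [exact: hyp_split_l|exact: teq_refl|].
  apply: teq_bang => //.
  apply: (@teq_id_app _ _ [:: Int (ty_sub s A), Off & G] [:: Int (ty_sub s A), Off & G]) => //.
  + by do 2 constructor.
  + exact: IA wA w _.
  + exact: ht_int.
- have [wc|nc] := boolP (ty_wf 0 (TPi A)).
    by rewrite fun_act_closed // (ty_sub_closed s wc); apply: teq_refl; apply: has_type_id;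
      rewrite ?(ty_wf_le _ wc).
  move: wf nc => /= wA /negbTE ->.
  apply: teq_lam => //.
  have nl' : no_linear (map (hyp_ren S) G) by rewrite no_linear_map.
  have sp' := hyp_split_no_linear nl'.
  set T := TPi _; have hv : has_type n (Lin T :: G) (Var 0) T by apply: ht_lin.
  apply: teq_trans (teq_eta_tlam hv); apply: teq_tlam => /=.
  have w' i : i < m.+1 -> ty_wf n.+1 (up_ty s i) by case: i => //= i /w ?; apply: ty_wf_renS.
  apply: (@teq_id_app _ _ (Off :: map (hyp_ren S) G) (Lin (ty_ren S T) :: map (hyp_ren S) G) _
    (ty_sub (up_ty s) A)) => //.
  + exact: hyp_split_r.
  + have := IA k.+1 (up_ty s) n.+1 m.+1 (Off :: map (hyp_ren S) G) wA w' nl'.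
    by rewrite tm_shift11 tm_shift_id_fun.
  set G2 := (_ :: _).
  have := @ht_tapp n.+1 G2 (ty_ren (upn S) (ty_sub (up_ty s) A)) (TVar 0) (Var 0) isT.
  rewrite /ty_inst ty_sub_ren (_ : scons _ _ \o _ = TVar) ?ty_sub_id; first by apply;
    apply: ht_lin.
  by apply: functional_extensionality; case.
Qed.

Lemma ty_wf_inst n m (A B : ty) : ty_wf n.+1 A -> ty_wf m B -> n <= m -> ty_wf m (ty_inst B A).
Proof.
move=> wA wB nm; apply: (ty_wf_sub wA) => -[|i] //= im.
by apply: leq_trans nm.
Qed.

Lemma functor_act_sub sigma A B f s e : ty_wf 1 sigma ->
  tm_sub s e (functor_act sigma A B f) =
  functor_act sigma (ty_sub s A) (ty_sub s B) (tm_sub s e f).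
(* The two sides carry substitutions that may differ from index 1 on, which [sigma] cannot see. *)
Proof. by move=> w; rewrite /functor_act fun_act_sub; apply: (fun_act_wf_ext _ _ w) => -[]. Qed.

Lemma functor_act_typed sigma n G A B f :
  ty_wf 1 sigma -> occurs_only true 0 sigma -> ty_wf n A -> ty_wf n B -> no_linear G ->
  has_type n G f (TLolli A B) ->
  has_type n G (functor_act sigma A B f) (TLolli (ty_inst A sigma) (ty_inst B sigma)).
Proof. by move=> w oc wA wB nl hf; apply: (fun_act_typed w _ _ _ oc nl) => // -[]. Qed.

Lemma functor_act_id sigma n G A :
  ty_wf 1 sigma -> ty_wf n A -> no_linear G ->
  teq n G (functor_act sigma A A (Lam A (Var 0))) (Lam (ty_inst A sigma) (Var 0))
    (TLolli (ty_inst A sigma) (ty_inst A sigma)).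
Proof. by move=> w wA nl; apply: (fun_act_id 0 (s := scons A TVar) w _ nl) => -[]. Qed.

(** * The algebra in : sigma(mu) -o mu *)

Lemma ty_inst_var0 sigma : ty_wf 1 sigma -> ty_inst (TVar 0) sigma = sigma.
Proof. by move=> w; apply: (ty_sub_wf_id w) => -[]. Qed.

Lemma ty_sub_inst sigma s A : ty_wf 1 sigma -> ty_sub s (ty_inst A sigma) = ty_inst (ty_sub s
  A) sigma.
Proof. by move=> w; rewrite /ty_inst ty_sub_sub; apply: (ty_sub_wf_ext w) => -[]. Qed.

Lemma ty_sub_wf1 sigma s : ty_wf 1 sigma -> ty_sub s sigma = ty_inst (s 0) sigma.
Proof. by move=> w; apply: (ty_sub_wf_ext w) => -[]. Qed.

Lemma mu_closed sigma : ty_wf 1 sigma -> ty_wf 0 (mu sigma).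
Proof. by move=> w; rewrite /= w. Qed.

Lemma mu_wf n sigma : ty_wf 1 sigma -> ty_wf n (mu sigma).
Proof. by move=> w; apply: (@ty_wf_le 0) => //; apply: mu_closed. Qed.

Definition alg (sigma A : ty) : ty := TLolli (ty_inst A sigma) A.

Lemma alg_wf n sigma A : ty_wf 1 sigma -> ty_wf n A -> ty_wf n (alg sigma A).
Proof. by move=> w wA; rewrite /= wA (@ty_wf_inst 0). Qed.

Lemma ty_inst_mu_body sigma A : ty_wf 1 sigma ->
  ty_inst A (TArr (TLolli sigma (TVar 0)) (TVar 0)) = TArr (alg sigma A) A.
Proof. by []. Qed.

Lemma ht_mu_app n G sigma x A f :
  ty_wf 1 sigma -> ty_wf n A -> no_linear G ->
  has_type n G x (mu sigma) -> has_type n G f (TBang (alg sigma A)) ->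
  has_type n G (App (TApp x A) f) A.
Proof.
move=> w wA nl hx hf; apply: ht_app (hyp_split_no_linear nl) _ hf.
exact: ht_tapp wA hx.
Qed.

Lemma fold_typed n G sigma : ty_wf 1 sigma -> no_linear G ->
  has_type n G (fold_tm sigma) (TPi (TArr (TLolli sigma (TVar 0)) (TLolli (mu sigma) (TVar 0)))).
Proof.
move=> w nl; have nl' : no_linear (map (hyp_ren S) G) by rewrite no_linear_map.
apply: ht_tlam; apply: has_type_LamI.
  by rewrite /= andbT (ty_wf_le _ w).
apply: ht_lam; first exact: mu_wf.
set T := TLolli sigma _.
apply: (@ht_app _ _ [:: Lin (mu sigma), Int T & map (hyp_ren S) G] [:: Off, Int T & map
  (hyp_ren S) G] (TBang T)).
- by do 2 constructor; apply: hyp_split_no_linear.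
- set G2 := (_ :: _).
  have := @ht_tapp n.+1 G2 _ (TVar 0) (Var 0) isT (ht_lin _ (erefl _ : onth G2 0 = Some (Lin
    (mu sigma))) _).
  rewrite ty_inst_mu_body // /alg ty_inst_var0 //; apply.
  exact: nl'.
- by apply: ht_bang => //; apply: ht_int.
Qed.

Definition fold_at (sigma A : ty) (f : tm) : tm := App (TApp (fold_tm sigma) A) (Bang f).

Lemma fold_at_typed n G sigma A f : ty_wf 1 sigma -> ty_wf n A -> no_linear G ->
  has_type n G f (alg sigma A) -> has_type n G (fold_at sigma A f) (TLolli (mu sigma) A).
Proof.
move=> w wA nl hf.
have := ht_tapp wA (fold_typed n w nl).
rewrite /ty_inst /= -/(ty_inst A sigma) => h.
apply: ht_app (hyp_split_no_linear nl) _ (ht_bang nl hf).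
have e := ty_sub_closed (scons A TVar) (mu_closed w).
by rewrite /= in e; rewrite e in h.
Qed.

(** The annotation [sigma] is open in the bound type variable 0, which the lifted substitution
    fixes; everything else is closed. The same reason applies to [in_tm] below. *)
Lemma tm_sub_closed_fold sigma s e : ty_wf 1 sigma -> tm_sub s e (fold_tm sigma) = fold_tm sigma.
Proof.
move=> w; have em := ty_sub_closed (up_ty s) (mu_closed w).
rewrite /fold_tm; cbn -[LamI mu]; rewrite tm_sub_LamI; cbn -[LamI mu].
by rewrite em (ty_sub_wf1 _ w) ty_inst_var0.
Qed.

Lemma tm_sub_closed_in sigma s e : ty_wf 1 sigma -> tm_sub s e (in_tm sigma) = in_tm sigma.
Proof.
move=> w; have em s' := ty_sub_closed s' (mu_closed w).
rewrite /in_tm; cbn -[LamI mu fold_tm functor_act]; rewrite tm_sub_LamI;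
  cbn -[LamI mu fold_tm functor_act].
rewrite functor_act_sub //; cbn -[LamI mu fold_tm functor_act].
by rewrite tm_sub_closed_fold // !em (ty_sub_wf1 _ w) ty_inst_var0 // ty_sub_inst // em.
Qed.

Lemma in_body_typed n G sigma :
  ty_wf 1 sigma -> occurs_only true 0 sigma -> no_linear G ->
  has_type n.+1 (Int (TLolli sigma (TVar 0)) :: Lin (ty_inst (mu sigma) sigma) :: G)
    (App (Var 0)
          (App (functor_act sigma (mu sigma) (TVar 0)
                  (App (TApp (fold_tm sigma) (TVar 0)) (Bang (Var 0))))
               (Var 1))) (TVar 0).
Proof.
move=> w oc nl; set T := TLolli sigma _; set U := ty_inst _ _.
have sp := hyp_split_no_linear nl.
apply: (@ht_app _ _ [:: Int T, Off & G] [:: Int T, Lin U & G] sigma).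
- by do 2 constructor.
- exact: ht_int.
apply: (@ht_app _ _ [:: Int T, Off & G] [:: Int T, Lin U & G] U).
- by do 2 constructor.
- rewrite -[X in TLolli _ X](ty_inst_var0 w); apply: functor_act_typed => //.
    exact: mu_wf.
  by apply: fold_at_typed => //; apply: ht_int; rewrite // /alg ty_inst_var0.
- exact: ht_lin.
Qed.

Lemma ht_app_nl n G A B t u : no_linear G ->
  has_type n G t (TLolli A B) -> has_type n G u A -> has_type n G (App t u) B.
Proof. by move/hyp_split_no_linear; apply: ht_app. Qed.

Lemma teq_app_nl n G A B t u t' u' : no_linear G ->
  teq n G t t' (TLolli A B) -> teq n G u u' A -> teq n G (App t u) (App t' u') B.
Proof. by move/hyp_split_no_linear; apply: teq_app. Qed.

Lemma tm_inst_shift t u : tm_inst u (tm_shift 0 1 t) = t.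
Proof. by rewrite /tm_inst /tm_shift tm_sub_ren -[RHS]tm_sub_id. Qed.

Lemma tm_tinst_shift t A : tm_tinst A (tm_shift 1 0 t) = t.
Proof. by rewrite /tm_tinst /tm_shift tm_sub_ren -[RHS]tm_sub_id. Qed.

Lemma alg_step_typed n G sigma A f z :
  ty_wf 1 sigma -> occurs_only true 0 sigma -> no_linear G -> ty_wf n A ->
  has_type n G f (alg sigma A) -> has_type n G z (ty_inst (mu sigma) sigma) ->
  has_type n G (App f (App (functor_act sigma (mu sigma) A (fold_at sigma A f)) z)) A.
Proof.
move=> w oc nl wA hf hz; apply: (ht_app_nl nl hf).
apply: (ht_app_nl nl _ hz); apply: functor_act_typed => //; first exact: mu_wf.
exact: fold_at_typed.
Qed.

Lemma in_typed n G sigma :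
  ty_wf 1 sigma -> occurs_only true 0 sigma -> no_linear G ->
  has_type n G (in_tm sigma) (alg sigma (mu sigma)).
Proof.
move=> w oc nl; apply: ht_lam; first by apply: (@ty_wf_inst 0) (mu_wf _ w) _.
apply: ht_tlam; apply: has_type_LamI; first by rewrite /= (ty_wf_le _ w).
have e : ty_ren S (ty_inst (mu sigma) sigma) = ty_inst (mu sigma) sigma.
  by rewrite ty_ren_sub_var ty_sub_inst // (ty_sub_closed _ (mu_closed w)).
by rewrite /= e; apply: in_body_typed => //; rewrite no_linear_map.
Qed.

(** Together with [teq_fold_app] this makes the fold h of an algebra f a homomorphism up to external
    equality: h (in z) = in z A !f = f (sigma(h) z). *)
Lemma teq_in_app n G sigma A f z :
  ty_wf 1 sigma -> occurs_only true 0 sigma -> no_linear G -> ty_wf n A ->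
  has_type n G f (alg sigma A) -> has_type n G z (ty_inst (mu sigma) sigma) ->
  teq n G (App (TApp (App (in_tm sigma) z) A) (Bang f))
    (App f (App (functor_act sigma (mu sigma) A (fold_at sigma A f)) z)) A.
Proof.
move=> w oc nl wA hf hz; have em s := ty_sub_closed s (mu_closed w).
have hin := in_typed n w oc nl.
have hinz := ht_app_nl nl hin hz.
(* The successive contractions fill the arguments of [body] one at a time: first [y] with [z], then
   [B] with [A], then [g] with [f]. *)
set body := fun B g y => App g (App (functor_act sigma (mu sigma) B (fold_at sigma B g)) y).
have e1 : teq n G (App (in_tm sigma) z)
    (TLam (LamI (TLolli sigma (TVar 0)) (body (TVar 0) (Var 0) (tm_shift 0 1 (tm_shift 1 0
      z))))) (mu sigma).
  rewrite (_ : TLam _ = tm_inst z (TLam (LamI (TLolli sigma (TVar 0)) (body (TVar 0) (Var 0)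
    (Var 1))))).
    exact: teq_beta_lam hinz.
  rewrite /tm_inst /body; cbn -[LamI mu fold_tm functor_act].
  rewrite tm_sub_LamI; cbn -[LamI mu fold_tm functor_act].
  by rewrite up_ty_id ty_sub_id functor_act_sub // em; cbn -[LamI mu fold_tm functor_act];
    rewrite tm_sub_closed_fold.
have nl' : no_linear (map (hyp_ren S) G) by rewrite no_linear_map.
have hz' : has_type n.+1 (map (hyp_ren S) G) (tm_shift 1 0 z) (ty_inst (mu sigma) sigma).
  have := has_type_ren_ty (m := n.+1) (r := S) hz (fun i => id).
  by rewrite ty_ren_sub_var ty_sub_inst // em.
have wT : ty_wf n.+1 (TLolli sigma (TVar 0)) by rewrite /= (ty_wf_le _ w).
have hb : has_type n.+1 (map (hyp_ren S) G)
   (LamI (TLolli sigma (TVar 0)) (body (TVar 0) (Var 0) (tm_shift 0 1 (tm_shift 1 0 z))))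
   (TArr (TLolli sigma (TVar 0)) (TVar 0)).
  apply: has_type_LamI => //; apply: alg_step_typed => //.
    by apply: ht_int; rewrite // /alg ty_inst_var0.
  exact: (has_type_shift (hs := [:: Int _]) hz').
have e2 : teq n G (TApp (App (in_tm sigma) z) A)
     (LamI (alg sigma A) (body A (Var 0) (tm_shift 0 1 z))) (TArr (alg sigma A) A).
  apply: teq_trans (teq_tapp wA e1) _.
  rewrite (_ : LamI (alg _ _) _ = tm_tinst A (LamI (TLolli sigma (TVar 0)) (body (TVar 0) (Var
    0) (tm_shift 0 1 (tm_shift 1 0 z))))).
    by apply: teq_beta_tlam; apply: ht_tapp wA (ht_tlam hb).
  rewrite /tm_tinst tm_sub_LamI /body; cbn -[LamI mu fold_tm functor_act].
  rewrite functor_act_sub // em; cbn -[LamI mu fold_tm functor_act].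
  rewrite tm_sub_closed_fold // (tm_sub_shift _ Var 1).
  by rewrite -/(tm_tinst A _) tm_tinst_shift.
apply: teq_trans (teq_app_nl nl e2 (teq_refl (ht_bang nl hf))) _.
rewrite (_ : App f _ = tm_inst f (body A (Var 0) (tm_shift 0 1 z))).
  apply: teq_beta_LamI => //; first exact: alg_wf.
  apply: alg_step_typed => //; first exact: ht_int.
  exact: (has_type_shift (hs := [:: Int _]) hz).
rewrite /tm_inst /body; cbn -[LamI mu fold_tm functor_act].
rewrite functor_act_sub // em; cbn -[LamI mu fold_tm functor_act].
by rewrite tm_sub_closed_fold // !ty_sub_id -/(tm_inst f _) tm_inst_shift.
Qed.

Lemma teq_fold_app n G sigma A f y :
  ty_wf 1 sigma -> no_linear G -> ty_wf n A ->
  has_type n G f (alg sigma A) -> has_type n G y (mu sigma) ->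
  teq n G (App (fold_at sigma A f) y) (App (TApp y A) (Bang f)) A.
Proof.
move=> w nl wA hf hy; have em s := ty_sub_closed s (mu_closed w).
have hfold := fold_typed n w nl.
have wm := mu_wf n w.
set b := Lam (mu sigma) (App (TApp (Var 0) A) (Bang (Var 1))).
have e1 : teq n G (TApp (fold_tm sigma) A) (LamI (alg sigma A) b)
    (TArr (alg sigma A) (TLolli (mu sigma) A)).
  rewrite (_ : LamI (alg _ _) _ = tm_tinst A (LamI (TLolli sigma (TVar 0))
    (Lam (mu sigma) (App (TApp (Var 0) (TVar 0)) (Bang (Var 1)))))); last first.
    by rewrite /tm_tinst tm_sub_LamI; cbn -[LamI mu]; rewrite em.
  have h := teq_beta_tlam (ht_tapp wA hfold).
  have e := em (scons A TVar).
  by rewrite /ty_inst /= in h; rewrite /= in e; rewrite e in h.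
have hb : has_type n (Int (alg sigma A) :: G) b (TLolli (mu sigma) A).
  apply: ht_lam => //.
  apply: (@ht_app _ _ [:: Lin (mu sigma), Int (alg sigma A) & G] [:: Off, Int (alg sigma A) &
    G] (TBang (alg sigma A))).
  - by do 2 constructor; apply: hyp_split_no_linear.
  - by apply: (ht_tapp wA (A := TArr (TLolli sigma (TVar 0)) (TVar 0))); apply: ht_lin.
  - by apply: ht_bang => //; apply: ht_int.
have e2 : teq n G (fold_at sigma A f) (Lam (mu sigma) (App (TApp (Var 0) A) (Bang (tm_shift 0 1
  f)))) (TLolli (mu sigma) A).
  apply: teq_trans (teq_app_nl nl e1 (teq_refl (ht_bang nl hf))) _.
  rewrite (_ : Lam _ _ = tm_inst f b).
    by apply: teq_beta_LamI => //; apply: alg_wf.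
  by rewrite /tm_inst; cbn -[mu]; rewrite em ty_sub_id.
apply: teq_trans (teq_app_nl nl e2 (teq_refl hy)) _.
rewrite (_ : App (TApp y A) _ = tm_inst y (App (TApp (Var 0) A) (Bang (tm_shift 0 1 f))));
  last first.
  by rewrite /tm_inst /= ty_sub_id -/(tm_inst y _) tm_inst_shift.
apply: teq_beta_lam; apply: (ht_app_nl nl _ hy); apply: ht_lam => //.
apply: (@ht_app _ _ [:: Lin (mu sigma) & G] [:: Off & G] (TBang (alg sigma A))).
- by constructor; apply: hyp_split_no_linear.
- by apply: (ht_tapp wA (A := TArr (TLolli sigma (TVar 0)) (TVar 0))); apply: ht_lin.
- by apply: ht_bang => //; apply: (has_type_shift (hs := [:: Off]) hf).
Qed.

(** * Contexts of LAPL and weakening *)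

Lemma no_linear_Int (G : seq ty) : no_linear (map Int G).
Proof. by elim: G. Qed.
#[local] Hint Resolve no_linear_Int : core.

Lemma tm_in_app C A B t u : tm_in C t (TLolli A B) -> tm_in C u A -> tm_in C (App t u) B.
Proof. exact: ht_app_nl. Qed.

Lemma tm_in_bang C A t : tm_in C t A -> tm_in C (Bang t) (TBang A).
Proof. exact: ht_bang. Qed.

Lemma tm_in_var C i A : onth (c_tm C) i = Some A -> tm_in C (Var i) A.
Proof. by move=> e; apply: ht_int => //; rewrite onth_map e. Qed.

Lemma tm_in_shift_tm C T t A : tm_in C t A -> tm_in (ext_tm T C) (tm_shift 0 1 t) A.
Proof. by move=> h; apply: (has_type_shift (hs := [:: Int T]) h). Qed.

Lemma tm_in_shift_tm2 C T T' t A :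
  tm_in C t A -> tm_in (ext_tm T (ext_tm T' C)) (tm_shift 0 2 t) A.
Proof. by move=> h; apply: (has_type_shift (hs := [:: Int T; Int T']) h). Qed.

Lemma tm_in_shift_ty C t A : tm_in C t A -> tm_in (ext_ty C) (tm_shift 1 0 t) (ty_ren S A).
Proof.
move=> h; have := has_type_ren_ty (m := (c_ty C).+1) (r := S) h (fun i => id).
by rewrite /tm_in /= -!map_comp.
Qed.

Lemma ctx_wf_tm A C : ctx_wf C -> ty_wf (c_ty C) A -> ctx_wf (ext_tm A C).
Proof. by rewrite /ctx_wf /= => /andP[-> ->] ->. Qed.

Lemma ctx_wf_ty C : ctx_wf C -> ctx_wf (ext_ty C).
Proof.
rewrite /ctx_wf /= !all_map => /andP[h1 h2]; apply/andP; split.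
  by apply: sub_all h1 => A /=; apply: ty_wf_renS.
by apply: sub_all h2 => d /= /andP[? ?]; rewrite !ty_wf_renS.
Qed.

Lemma ctx_wf_rel a A B C :
  ctx_wf C -> ty_wf (c_ty C) A -> ty_wf (c_ty C) B -> ctx_wf (ext_rel a A B C).
Proof. by rewrite /ctx_wf /= => /andP[-> ->] -> ->. Qed.

(** Recording only how lookups move makes the order irrelevant in which type, term and relation
    binders are interleaved. *)
Record wk (a b c : nat) (C C' : ctx) : Prop := Wk {
  wk_ty : c_ty C' = a + c_ty C;
  wk_tm : forall i A, onth (c_tm C) i = Some A ->
    onth (c_tm C') (b + i) = Some (ty_ren (addn a) A);
  wk_rel : forall i d, onth (c_rel C) i = Some d ->
    onth (c_rel C') (c + i) = Some (rd_ren (addn a) d) }.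

Lemma rd_ren_ren r r' d : rd_ren r (rd_ren r' d) = rd_ren (r \o r') d.
Proof. by case: d => a A B; rewrite /rd_ren /= !ty_ren_ren. Qed.

Lemma rd_ren_id d : rd_ren id d = d.
Proof. by case: d => a A B; rewrite /rd_ren /= !ty_ren_id. Qed.

Lemma wk0 C : wk 0 0 0 C C.
Proof. by split=> // i [] *; rewrite ?(rd_ren_id, ty_ren_id). Qed.

Lemma wk_ext_tm a b c C C' T : wk a b c C C' -> wk a b.+1 c C (ext_tm T C').
Proof. by case=> h1 h2 h3; split. Qed.

Lemma wk_ext_rel a b c C C' x A B : wk a b c C C' -> wk a b c.+1 C (ext_rel x A B C').
Proof. by case=> h1 h2 h3; split. Qed.

Lemma wk_ext_ty a b c C C' : wk a b c C C' -> wk a.+1 b c C (ext_ty C').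
Proof.
case=> h1 h2 h3; split=> [|i A /h2 e|i d /h3 e] /=; first by rewrite h1.
  by rewrite onth_map e /= ty_ren_ren.
by rewrite onth_map e /= rd_ren_ren.
Qed.

Lemma ty_ren0 A : ty_ren (addn 0) A = A.
Proof. exact: ty_ren_id. Qed.

(** A weakening is a substitution of variables by variables, so this is an instance of stability
    under substitution. *)
Lemma adm_wk L a b c C C' r A B : adm_class L -> wk a b c C C' -> ctx_wf C -> ctx_wf C' ->
  adm L C r A B -> adm L C' (rel_shift a b c r) (ty_ren (addn a) A) (ty_ren (addn a) B).
Proof.
move=> hadm [h1 h2 h3] wC wC' hr.
rewrite /rel_shift rel_ren_sub_var !(ty_ren_sub_var _ (addn a)).
apply: (adm_sub hadm wC wC' _ hr); split.
- by move=> i iC; rewrite /= h1 ltn_add2l.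
- by move=> i T /h2 e; rewrite -ty_ren_sub_var; apply: tm_in_var.
- move=> i [] T T' /h3 e; rewrite -!ty_ren_sub_var /rel_ok /=.
    exact: (adm_var hadm wC' e).
  exact: wf_rvar e.
Qed.

Lemma rel_env_wk L a b c C C' n rs s s' : adm_class L -> wk a b c C C' -> ctx_wf C -> ctx_wf C' ->
  rel_env L C n rs s s' ->
  rel_env L C' n (map (rel_shift a b c) rs) (ty_ren (addn a) \o s) (ty_ren (addn a) \o s').
Proof.
move=> hadm w wC wC' [sz h]; split; first by rewrite size_map.
move=> i im; have [w1 w2 ha] := h i im; split.
- by apply: (ty_wf_ren w1) => j jC; rewrite (wk_ty w) ltn_add2l.
- by apply: (ty_wf_ren w2) => j jC; rewrite (wk_ty w) ltn_add2l.
- by rewrite (nth_map (RVar 0)) ?sz //; apply: (adm_wk hadm w).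
Qed.

(** * Derived rules *)

Lemma form_sub_eq F s e r s' e' r' :
  (forall i, s i = s' i) -> (forall i, e i = e' i) -> (forall i, r i = r' i) ->
  form_sub s e r F = form_sub s' e' r' F.
Proof.
by move=> /functional_extensionality -> /functional_extensionality ->
  /functional_extensionality ->.
Qed.

Lemma ty_sub_idE A s : (forall i, s i = TVar i) -> ty_sub s A = A.
Proof. by move=> h; rewrite -[RHS]ty_sub_id; congr ty_sub; apply: functional_extensionality. Qed.

(** The axioms of a theory need not be stable under weakening of the context, so
    derivations cannot be weakened; a fact to be used below a quantifier has to be
    cut in as a hypothesis first. *)
Lemma pr_cut L C H P Q : form_wf L C P -> prov L C H P -> prov L C (P :: H) Q -> prov L C H Q.
Proof. by move=> w hP hQ; apply: pr_impE hP; apply: pr_impI. Qed.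

Lemma pr_allTm2E L C H A B P t u : tm_in C t A -> tm_in C u B ->
  prov L C H (PAllTm A (PAllTm B P)) -> prov L C H (form_inst_tm2 t u P).
Proof.
move=> ht hu /(pr_allTmE ht); rewrite /form_inst_tm /= ty_sub_id => /(pr_allTmE hu).
rewrite /form_inst_tm form_sub_sub (@form_sub_eq _ _ _ _ TVar (scons u (scons t Var)) RVar) //.
by move=> [|[|i]] //=; apply: tm_inst_shift.
Qed.

Lemma pr_allTyTyAdmE L C H P A B r :
  ty_wf (c_ty C) A -> ty_wf (c_ty C) B -> adm L C r A B ->
  prov L C H (PAllTy (PAllTy (PAllAdm (TVar 1) (TVar 0) P))) ->
  prov L C H (form_sub (scons B (scons A TVar)) Var (scons r RVar) P).
Proof.
move=> wA wB hr /(pr_allTyE wA); rewrite /form_inst_ty /= => /(pr_allTyE wB).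
rewrite /form_inst_ty /= ty_sub_ren ty_sub_id.
have hr' : rel_ok L true C r A B by [].
move=> /(pr_allRelE hr'); rewrite /form_inst_rel !form_sub_sub.
rewrite (@form_sub_eq _ _ _ _ (scons B (scons A TVar)) Var (scons r RVar)) //.
- case=> [|[|i]] //=; first exact: ty_sub_id.
  by rewrite ty_sub_ren; apply: ty_sub_idE.
- by move=> [|i].
Qed.

Lemma pr_compE L C H A B P t u : form_wf L C (PRel (RComp A B P) t u) ->
  prov L C H (PRel (RComp A B P) t u) -> prov L C H (form_inst_tm2 t u P).
Proof. by move=> w; apply: pr_impE; apply: pr_andE1 (pr_comp H w). Qed.

Lemma pr_compI L C H A B P t u : form_wf L C (PRel (RComp A B P) t u) ->
  prov L C H (form_inst_tm2 t u P) -> prov L C H (PRel (RComp A B P) t u).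
Proof. by move=> w; apply: pr_impE; apply: pr_andE2 (pr_comp H w). Qed.

Lemma rel_sub_shift R s e r a b c :
  (forall i, s (a + i) = TVar i) -> (forall i, e (b + i) = Var i) ->
  (forall i, r (c + i) = RVar i) -> rel_sub s e r (rel_shift a b c R) = R.
Proof.
move=> hs he hr; rewrite /rel_shift rel_sub_ren -[RHS]rel_sub_id.
by congr rel_sub; apply: functional_extensionality => i /=.
Qed.

Lemma tm_sub_shift_id t s e a b :
  (forall i, s (a + i) = TVar i) -> (forall i, e (b + i) = Var i) ->
  tm_sub s e (tm_shift a b t) = t.
Proof.
move=> hs he; rewrite /tm_shift tm_sub_ren -[RHS]tm_sub_id.
by congr tm_sub; apply: functional_extensionality => i /=.
Qed.

Lemma pr_rel_equivE L C H A B r r' t u : tm_in C t A -> tm_in C u B ->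
  prov L C H (rel_equiv A B r r') -> prov L C H (PIff (PRel r t u) (PRel r' t u)).
Proof.
move=> ht hu /(pr_allTm2E ht hu); rewrite /form_inst_tm2 /=.
by rewrite !rel_sub_shift //; case=> [|[]].
Qed.

Lemma pr_rel_equivL L C H A B r r' t u : tm_in C t A -> tm_in C u B ->
  prov L C H (rel_equiv A B r r') -> prov L C H (PRel r t u) -> prov L C H (PRel r' t u).
Proof. by move=> ht hu /(pr_rel_equivE ht hu)/pr_andE1/pr_impE; apply. Qed.

Lemma pr_rel_equivR L C H A B r r' t u : tm_in C t A -> tm_in C u B ->
  prov L C H (rel_equiv A B r r') -> prov L C H (PRel r' t u) -> prov L C H (PRel r t u).
Proof. by move=> ht hu /(pr_rel_equivE ht hu)/pr_andE2/pr_impE; apply. Qed.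

Lemma rel_env_wf L C n rs s s' A : rel_env L C n rs s s' -> ty_wf n A ->
  ty_wf (c_ty C) (ty_sub s A) /\ ty_wf (c_ty C) (ty_sub s' A).
Proof. by case=> _ h w; split; apply: (ty_wf_sub w) => i /h[]. Qed.

Lemma rel_env_nil L C s s' : rel_env L C 0 [::] s s'.
Proof. by []. Qed.

Lemma rel_env_cons L C n rs s s' A B r :
  ty_wf (c_ty C) A -> ty_wf (c_ty C) B -> adm L C r A B ->
  rel_env L C n rs s s' -> rel_env L C n.+1 (r :: rs) (scons A s) (scons B s').
Proof. by move=> wA wB hr [sz h]; split; [rewrite /= sz|case=> [|i] //=; apply: h]. Qed.

(** Instantiated rules yield propositions full of pending substitutions; this isolates their
    computation in three syntactic equations. *)
Lemma pr_rel_eq L C H r r' t t' u u' :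
  prov L C H (PRel r t u) -> r = r' -> t = t' -> u = u' -> prov L C H (PRel r' t' u').
Proof. by move=> h <- <- <-. Qed.

(** * Rules for the relational interpretation of lolli and Pi *)

Section Rules.
Variables (L : theory) (hadm : adm_class L).

Lemma adm_shift_tm2 C T T' r A B : ctx_wf C -> ctx_wf (ext_tm T (ext_tm T' C)) ->
  adm L C r A B -> adm L (ext_tm T (ext_tm T' C)) (rel_shift 0 2 0 r) A B.
Proof.
move=> wC wC' /(adm_wk hadm (wk_ext_tm T (wk_ext_tm T' (wk0 C))) wC wC').
by rewrite !ty_ren0.
Qed.

Lemma form_wf_adm C r A B t u :
  ctx_wf C -> adm L C r A B -> tm_in C t A -> tm_in C u B -> form_wf L C (PRel r t u).
Proof. by move=> wC hr ht hu; apply: wf_rel (adm_definable hadm wC hr) ht hu. Qed.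

Section Lolli.
Variables (C : ctx) (H : seq form) (A B A' B' : ty) (r r' : drel) (f g : tm).
Hypotheses (wC : ctx_wf C) (wA : ty_wf (c_ty C) A) (wB : ty_wf (c_ty C) B).
Hypotheses (wA' : ty_wf (c_ty C) A') (wB' : ty_wf (c_ty C) B').
Hypotheses (hr : adm L C r A B) (hr' : adm L C r' A' B').
Hypotheses (hf : tm_in C f (TLolli A A')) (hg : tm_in C g (TLolli B B')).

(** Comprehension unfolds only well-formed propositions; [form_wf_rpi] and [form_wf_rbang] are there
    for the same reason. *)
Lemma form_wf_rlolli : form_wf L C (PRel (rlolli A B A' B' r r') f g).
Proof.
apply: wf_rel hf hg; apply: wf_rcomp; rewrite /= ?wA ?wB //.
apply: wf_qtm => //; apply: wf_qtm => //.
(* Four variables are added: the two functions bound by [rlolli] and their two arguments. *)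
set C4 := ext_tm B _.
have w4 : ctx_wf C4.
  by do 4 (apply: ctx_wf_tm; rewrite /= ?wA ?wB ?wA' ?wB' //).
have k4 : wk 0 4 0 C C4 by do 4 apply: wk_ext_tm; apply: wk0.
have := adm_wk hadm k4 wC w4 hr; have := adm_wk hadm k4 wC w4 hr'.
rewrite !ty_ren0 => a4' a4; apply: wf_imp.
  by apply: form_wf_adm a4 _ _ => //; apply: tm_in_var.
by apply: form_wf_adm a4' _ _ => //; (apply: tm_in_app; last exact: tm_in_var); apply: tm_in_var.
Qed.

Lemma pr_rlolliE t u : tm_in C t A -> tm_in C u B ->
  prov L C H (PRel (rlolli A B A' B' r r') f g) ->
  prov L C H (PRel r t u) -> prov L C H (PRel r' (App f t) (App g u)).
Proof.
move=> ht hu /(pr_compE form_wf_rlolli).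
rewrite /form_inst_tm2 /= !ty_sub_id => /(pr_allTm2E ht hu); rewrite /form_inst_tm2 /=.
move=> h1 h2; apply: pr_rel_eq (pr_impE h1 _) _ _ _.
- apply: pr_rel_eq h2 _ _ _ => //.
  by rewrite rel_sub_sub rel_sub_shift //; do 5 (case=> //).
- by rewrite rel_sub_sub rel_sub_shift //; do 5 (case=> //).
- by congr App; rewrite /tm_shift !tm_sub_ren; apply: tm_sub_id.
- by congr App; rewrite /tm_shift !tm_sub_ren; apply: tm_sub_id.
Qed.

Lemma pr_rlolliI :
  prov L (ext_tm B (ext_tm A C))
    (PRel (rel_shift 0 2 0 r) (Var 1) (Var 0) :: pshift 0 1 0 (pshift 0 1 0 H))
    (PRel (rel_shift 0 2 0 r') (App (tm_shift 0 2 f) (Var 1)) (App (tm_shift 0 2 g) (Var 0))) ->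
  prov L C H (PRel (rlolli A B A' B' r r') f g).
Proof.
move=> h; apply: (pr_compI form_wf_rlolli).
rewrite /form_inst_tm2 /= !ty_sub_id.
apply: pr_allTmI => //; apply: pr_allTmI => //.
(* Of the four variables over which [R] was shifted, the two functions are instantiated and the two
   arguments remain. *)
have e R : rel_sub TVar (up_tm (up_tm (scons g (scons f Var))))
    (fun i => rel_shift 0 1 0 (rel_shift 0 1 0 (RVar i))) (rel_shift 0 4 0 R) =
    rel_shift 0 2 0 R.
  rewrite /rel_shift rel_sub_ren rel_ren_sub_var; congr rel_sub.
rewrite !e.
have w2 : ctx_wf (ext_tm B (ext_tm A C)) by do 2 apply: ctx_wf_tm => //.
apply: pr_impI.
  by apply: form_wf_adm (adm_shift_tm2 wC w2 hr) _ _ => //; apply: tm_in_var.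
by apply: pr_rel_eq h _ _ _ => //; congr App; rewrite /= /tm_shift tm_ren_ren.
Qed.
End Lolli.

Section Int.
Variables (C : ctx) (H : seq form) (n : nat) (rs : seq drel) (s s' : nat -> ty).
Hypotheses (wC : ctx_wf C) (hrs : rel_env L C n rs s s').

Lemma pr_int_lolliE A A' f g t u :
  ty_wf n A -> ty_wf n A' ->
  tm_in C f (ty_sub s (TLolli A A')) -> tm_in C g (ty_sub s' (TLolli A A')) ->
  tm_in C t (ty_sub s A) -> tm_in C u (ty_sub s' A) ->
  prov L C H (PRel (RInt (TLolli A A') rs) f g) -> prov L C H (PRel (RInt A rs) t u) ->
  prov L C H (PRel (RInt A' rs) (App f t) (App g u)).
Proof.
move=> wA wA' hf hg ht hu h.
have [w1 w2] := rel_env_wf hrs wA; have [w1' w2'] := rel_env_wf hrs wA'.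
have h' := pr_rel_equivL hf hg (pr_int_lolli H hrs wA wA') h.
by move=> h2; apply: (pr_rlolliE wC w1 w2 w1' w2' _ _ hf hg ht hu h' h2);
  apply: (adm_int hadm _ _ hrs).
Qed.

Lemma pr_int_lolliI A A' f g :
  ty_wf n A -> ty_wf n A' ->
  tm_in C f (ty_sub s (TLolli A A')) -> tm_in C g (ty_sub s' (TLolli A A')) ->
  prov L (ext_tm (ty_sub s' A) (ext_tm (ty_sub s A) C))
    (PRel (RInt A (map (rel_shift 0 2 0) rs)) (Var 1) (Var 0) :: pshift 0 1 0 (pshift 0 1 0 H))
    (PRel (RInt A' (map (rel_shift 0 2 0) rs)) (App (tm_shift 0 2 f) (Var 1)) (App (tm_shift 0
      2 g) (Var 0))) ->
  prov L C H (PRel (RInt (TLolli A A') rs) f g).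
Proof.
move=> wA wA' hf hg h.
have [w1 w2] := rel_env_wf hrs wA; have [w1' w2'] := rel_env_wf hrs wA'.
apply: (pr_rel_equivR hf hg (pr_int_lolli H hrs wA wA')).
by apply: (pr_rlolliI wC w1 w2 w1' w2' _ _ hf hg _) => //; apply: (adm_int hadm _ _ hrs).
Qed.

Lemma form_wf_rpi A t u :
  ty_wf n.+1 A -> tm_in C t (ty_sub s (TPi A)) -> tm_in C u (ty_sub s' (TPi A)) ->
  form_wf L C (PRel (rpi (ty_sub (up_ty s) A) (ty_sub (up_ty s') A)
           (RInt A (RVar 0 :: map (rel_shift 2 2 1) rs))) t u).
Proof.
move=> wA ht hu.
have [w1 w2] := rel_env_wf hrs (wA : ty_wf n (TPi A)).
apply: wf_rel ht hu; apply: wf_rcomp => //.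
do 2 apply: wf_qty; apply: wf_qrel => //.
set C' := ext_rel _ _ _ _.
have w' : ctx_wf C'.
  by apply: ctx_wf_rel => //; do 2 apply: ctx_wf_ty; do 2 apply: ctx_wf_tm => //.
have k' : wk 2 2 1 C C'.
  by apply: wk_ext_rel; do 2 apply: wk_ext_ty; do 2 apply: wk_ext_tm; apply: wk0.
have hrs' := rel_env_cons (A := TVar 1) (B := TVar 0) (r := RVar 0)
  _ _ _ (rel_env_wk hadm k' wC w' hrs).
have e s0 X : ty_inst X (ty_ren (upn S) (ty_ren (upn S) (ty_sub (up_ty s0) A))) =
    ty_sub (scons X (ty_ren (addn 2) \o s0)) A.
  rewrite /ty_inst !ty_sub_ren ty_sub_sub.
  congr ty_sub; apply: functional_extensionality => -[|i] //=.
  by rewrite ty_sub_ren ty_ren_sub_var.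
apply: (wf_rel (A := ty_sub (scons (TVar 1) (ty_ren (addn 2) \o s)) A)
               (B := ty_sub (scons (TVar 0) (ty_ren (addn 2) \o s')) A)).
- by apply: wf_rint wA (hrs' _ _ _) => //; apply: adm_var.
- by rewrite -e; apply: ht_tapp => //; apply: tm_in_var.
- by rewrite -e; apply: ht_tapp => //; apply: tm_in_var.
Qed.

Lemma pr_int_piE A t u r B B' :
  ty_wf n.+1 A -> tm_in C t (ty_sub s (TPi A)) -> tm_in C u (ty_sub s' (TPi A)) ->
  ty_wf (c_ty C) B -> ty_wf (c_ty C) B' -> adm L C r B B' ->
  prov L C H (PRel (RInt (TPi A) rs) t u) ->
  prov L C H (PRel (RInt A (r :: rs)) (TApp t B) (TApp u B')).
Proof.
move=> wA ht hu wB wB' hr /(pr_rel_equivL ht hu (pr_int_pi H hrs wA)).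
move/(pr_compE (form_wf_rpi wA ht hu)); rewrite /form_inst_tm2 /=.
move/(pr_allTyTyAdmE wB wB' hr) => /= h; apply: pr_rel_eq h _ _ _.
(* The shift by two types, two terms and one relation cancels against the instantiation of exactly
   these. *)
- congr (RInt _ (_ :: _)); rewrite -!map_comp -[RHS]map_id; apply: eq_map => R /=.
  rewrite rel_sub_sub rel_sub_shift //.
- congr TApp; rewrite /tm_shift !tm_sub_ren; exact: tm_sub_id.
- congr TApp; rewrite /tm_shift !tm_sub_ren; exact: tm_sub_id.
Qed.

End Int.
End Rules.

(** * Internal equality, graphs and instances of identity extension *)

Section Equality.
Variables (L : theory) (hadm : adm_class L) (C : ctx) (H : seq form).
Hypothesis wC : ctx_wf C.

Lemma pr_eq_refl A t : tm_in C t A -> prov L C H (PEq A t t).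
Proof. by move=> ht; apply: pr_eqI => //; apply: teq_refl. Qed.

Lemma pr_eq_trans A t u v : tm_in C t A -> tm_in C u A -> tm_in C v A ->
  prov L C H (PEq A t u) -> prov L C H (PEq A u v) -> prov L C H (PEq A t v).
Proof.
move=> ht hu hv h1 h2.
(* Transitivity is replacement in the predicate stating equality with [t]. *)
have e x : form_inst_tm x (PEq A (tm_shift 0 1 t) (Var 0)) = PEq A t x.
  by rewrite /form_inst_tm /= ty_sub_id -/(tm_inst x _) tm_inst_shift.
rewrite -e; apply: pr_eqE h2 _; last by rewrite e.
by apply: wf_eq; [apply: tm_in_shift_tm|apply: tm_in_var].
Qed.

Lemma pr_eq_app A B f t u : tm_in C f (TLolli A B) -> tm_in C t A -> tm_in C u A ->
  prov L C H (PEq A t u) -> prov L C H (PEq B (App f t) (App f u)).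
Proof.
move=> hf ht hu h.
have e x : form_inst_tm x (PEq B (tm_shift 0 1 (App f t)) (App (tm_shift 0 1 f) (Var 0))) =
    PEq B (App f t) (App f x).
  rewrite /form_inst_tm /=; congr (PEq _ (App _ _) (App _ _)); rewrite ?ty_sub_id //;
    exact: tm_inst_shift.
rewrite -e; apply: pr_eqE h _; last first.
  by rewrite e; apply: pr_eq_refl; apply: tm_in_app ht.
apply: wf_eq; first by apply: tm_in_shift_tm; apply: tm_in_app ht.
by apply: tm_in_app; [apply: tm_in_shift_tm hf|apply: tm_in_var].
Qed.

Lemma pr_reqE A t u : ty_wf (c_ty C) A -> tm_in C t A -> tm_in C u A ->
  prov L C H (PRel (req A) t u) -> prov L C H (PEq A t u).
Proof.
move=> wA ht hu; have w := form_wf_adm hadm wC (adm_eq hadm wC wA) ht hu.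
by move/(pr_compE w); rewrite /form_inst_tm2 /= ty_sub_id.
Qed.

Lemma pr_reqI A t u : ty_wf (c_ty C) A -> tm_in C t A -> tm_in C u A ->
  prov L C H (PEq A t u) -> prov L C H (PRel (req A) t u).
Proof.
move=> wA ht hu; have w := form_wf_adm hadm wC (adm_eq hadm wC wA) ht hu.
by move=> h; apply: (pr_compI w); rewrite /form_inst_tm2 /= ty_sub_id.
Qed.

Lemma form_inst_graph B f t u :
  form_inst_tm2 t u (PEq B (App (tm_shift 0 2 f) (Var 1)) (Var 0)) = PEq B (App f t) u.
Proof. by rewrite /form_inst_tm2 /= ty_sub_id tm_sub_shift_id //; case=> [|[|]]. Qed.

Lemma pr_graphE A B f t u :
  ty_wf (c_ty C) A -> ty_wf (c_ty C) B -> tm_in C f (TLolli A B) ->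
  tm_in C t A -> tm_in C u B ->
  prov L C H (PRel (rel_graph A B f) t u) -> prov L C H (PEq B (App f t) u).
Proof.
move=> wA wB hf ht hu.
have w := form_wf_adm hadm wC (adm_graph hadm wC wA wB hf) ht hu.
by move/(pr_compE w); rewrite form_inst_graph.
Qed.

Lemma pr_graphI A B f t u :
  ty_wf (c_ty C) A -> ty_wf (c_ty C) B -> tm_in C f (TLolli A B) ->
  tm_in C t A -> tm_in C u B ->
  prov L C H (PEq B (App f t) u) -> prov L C H (PRel (rel_graph A B f) t u).
Proof.
move=> wA wB hf ht hu.
have w := form_wf_adm hadm wC (adm_graph hadm wC wA wB hf) ht hu.
by move=> h; apply: (pr_compI w); rewrite form_inst_graph.
Qed.

Hypothesis hid : identity_extension L.

Lemma pr_id_ext0 A t : ty_wf 0 A -> tm_in C t A -> prov L C H (PRel (RInt A [::]) t t).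
Proof.
move=> wA ht; have h : prov L C H (id_ext 0 A) by apply: pr_weak (hid wC wA).
apply: (pr_rel_equivR ht ht h); apply: pr_reqI => //; last exact: pr_eq_refl.
by rewrite (ty_wf_le _ wA).
Qed.

Definition sub2 (B0 B1 : ty) : nat -> ty := scons B0 (scons B1 TVar).

(** The two parameters are those of [poly_act_type]. The other types at which this is used,
    [mu sigma] and the type of algebras, mention at most the first. *)
Lemma pr_id_ext2 A B0 B1 : ty_wf 2 A -> ty_wf (c_ty C) B0 -> ty_wf (c_ty C) B1 ->
  prov L C H (rel_equiv (ty_sub (sub2 B0 B1) A) (ty_sub (sub2 B0 B1) A)
    (RInt A [:: req B0; req B1]) (req (ty_sub (sub2 B0 B1) A))).
Proof.
move=> wA w0 w1; have h : prov L C H (id_ext 2 A) by apply: pr_weak (hid wC wA).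
(* The outer quantifier binds variable 1, so [B1] is instantiated first. *)
move: h => /(pr_allTyE w1); rewrite /form_inst_ty /= => /(pr_allTyE w0).
rewrite /form_inst_ty /rel_equiv /req /= /rel_shift /=.
have e X : ty_sub (scons B0 TVar) (ty_sub (up_ty (scons X TVar)) A) = ty_sub (sub2 B0 X) A.
  rewrite ty_sub_sub; congr ty_sub; apply: functional_extensionality => -[|[|i]] //=.
  by rewrite ty_sub_ren; apply: ty_sub_idE.
have e1 : ty_sub (scons B0 TVar \o S) B1 = B1 by apply: ty_sub_idE.
by rewrite !e !ty_ren_id !ty_sub_ren e1 !e.
Qed.

End Equality.

(** * The relation on bang types *)

Section Bang.
Variables (L : theory) (hadm : adm_class L) (C : ctx) (H : seq form).
Variables (A B : ty) (r : drel) (p q : tm).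
Hypotheses (wC : ctx_wf C) (wA : ty_wf (c_ty C) A) (wB : ty_wf (c_ty C) B).
Hypotheses (hr : adm L C r A B) (hp : tm_in C p (TBang A)) (hq : tm_in C q (TBang B)).

Lemma form_wf_rbang : form_wf L C (PRel (rbang A B r) p q).
Proof.
have wr X : ty_wf (c_ty C) X -> ty_wf (c_ty C).+2 (ty_ren (addn 2) X).
  by move=> w; apply: (ty_wf_ren w).
have wA2 := wr _ wA; have wB2 := wr _ wB.
apply: wf_rel hp hq; apply: wf_rcomp => //.
do 2 apply: wf_qty; apply: wf_qrel => //.
apply: wf_qtm; first by rewrite /= wA2.
apply: wf_qtm; first by rewrite /= wB2.
(* Seven variables are added: the two related terms, two types, a relation between them and two
   functions. [C9] below also has the arguments of these functions. *)
set C7 := ext_tm _ _.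
have w7 : ctx_wf C7.
  apply: ctx_wf_tm; last by rewrite /= wB2.
  apply: ctx_wf_tm; last by rewrite /= wA2.
  by apply: ctx_wf_rel => //; do 2 apply: ctx_wf_ty; do 2 apply: ctx_wf_tm => //.
have tv x y X T : onth (c_tm C7) x = Some (ty_ren S (ty_ren S T)) ->
    X = ty_ren (addn 2) T -> y = x -> tm_in C7 (Var y) X.
  by move=> e -> ->; apply: tm_in_var; rewrite e ty_ren_ren.
apply: wf_imp; last first.
  apply: (form_wf_adm hadm w7 (A := TVar 1) (B := TVar 0)); first exact: adm_var.
    by apply: (tm_in_app (A := ty_ren (addn 2) (TBang A)));
      [exact: tm_in_var|exact: (tv 3 _ _ (TBang A))].
  by apply: (tm_in_app (A := ty_ren (addn 2) (TBang B)));
    [exact: tm_in_var|exact: (tv 2 _ _ (TBang B))].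
apply: wf_qtm => //; apply: wf_qtm => //.
set C9 := ext_tm _ (ext_tm _ C7).
have w9 : ctx_wf C9 by do 2 apply: ctx_wf_tm => //.
have k9 : wk 2 6 1 C C9.
  do 4 apply: wk_ext_tm; apply: wk_ext_rel; do 2 apply: wk_ext_ty.
  by do 2 apply: wk_ext_tm; apply: wk0.
apply: wf_imp.
  by apply: (form_wf_adm hadm w9 (adm_wk hadm k9 wC w9 hr)); apply: tm_in_var.
apply: (form_wf_adm hadm w9 (A := TVar 1) (B := TVar 0)); first exact: adm_var.
  by apply: (tm_in_app (A := TBang (ty_ren (addn 2) A))); [exact: tm_in_var|apply: tm_in_bang;
    exact: tm_in_var].
by apply: (tm_in_app (A := TBang (ty_ren (addn 2) B))); [exact: tm_in_var|apply: tm_in_bang;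
  exact: tm_in_var].
Qed.

(** The quantification over all targets in [rbang] acts as an induction principle: the conclusion
    concerns arbitrary [p] and [q], while the premise has to be checked on values alone. *)
Lemma pr_rbangE X Y r' t u :
  ty_wf (c_ty C) X -> ty_wf (c_ty C) Y -> adm L C r' X Y ->
  tm_in C t (TArr A X) -> tm_in C u (TArr B Y) ->
  prov L C H (PAllTm A (PAllTm B
    (PImp (PRel (rel_shift 0 2 0 r) (Var 1) (Var 0))
          (PRel (rel_shift 0 2 0 r') (App (tm_shift 0 2 t) (Bang (Var 1)))
                                     (App (tm_shift 0 2 u) (Bang (Var 0))))))) ->
  prov L C H (PRel (rbang A B r) p q) -> prov L C H (PRel r' (App t p) (App u q)).
Proof.
move=> wX wY hr' ht hu hpre /(pr_compE form_wf_rbang).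
rewrite /form_inst_tm2 /= => /(pr_allTyTyAdmE wX wY hr') /=.
have eT T : ty_sub (scons Y (scons X TVar)) (ty_sub (up_ty (up_ty TVar)) (ty_ren (addn 2) T)) = T.
  by rewrite ty_sub_sub ty_sub_ren; apply: ty_sub_idE.
rewrite !eT => /(pr_allTm2E ht hu); rewrite /form_inst_tm2 /= !ty_sub_id => h.
apply: pr_rel_eq (pr_impE h _) _ _ _ => //=.
(* What remains are comparisons of substitutions: with renamings turned into substitutions and
   everything fused, both sides agree pointwise. *)
- congr (prov L C H (PAllTm A (PAllTm B (PImp (PRel _ _ _) (PRel _ _ _))))): hpre.
  + rewrite /rel_shift rel_ren_sub_var !rel_sub_sub rel_sub_ren.
    by congr rel_sub; apply: functional_extensionality.
  + rewrite /rel_shift rel_ren_sub_var !rel_ren_sub_var !rel_sub_sub.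
    by congr rel_sub; apply: functional_extensionality.
  + congr App; rewrite /tm_shift tm_ren_sub_var !tm_ren_sub_var !tm_sub_sub.
    by congr tm_sub; apply: functional_extensionality.
  + congr App; rewrite /tm_shift tm_ren_sub_var !tm_ren_sub_var !tm_sub_sub.
    by congr tm_sub; apply: functional_extensionality.
- rewrite /rel_shift !rel_ren_sub_var !rel_sub_sub -[RHS]rel_sub_id.
  by congr rel_sub; apply: functional_extensionality.
- congr App; rewrite /tm_shift !tm_ren_sub_var !tm_sub_sub -[RHS]tm_sub_id.
  by congr tm_sub; apply: functional_extensionality.
- congr App; rewrite /tm_shift !tm_ren_sub_var !tm_sub_sub -[RHS]tm_sub_id.
  by congr tm_sub; apply: functional_extensionality.
Qed.
End Bang.

Lemma tm_in_tapp C t s A B : ty_wf (c_ty C) B ->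
  tm_in C t (ty_sub s (TPi A)) -> tm_in C (TApp t B) (ty_sub (scons B s) A).
Proof.
move=> wB ht; have := ht_tapp wB ht.
rewrite /ty_inst ty_sub_sub (_ : ty_sub _ \o _ = scons B s) //.
by apply: functional_extensionality => -[|i] //=; rewrite ty_sub_ren; apply: ty_sub_idE.
Qed.

Lemma rel_shift_req b A : rel_shift 0 b 0 (req A) = req A.
Proof. by rewrite /rel_shift /req /= ty_ren_id. Qed.

Lemma rel_shift_graph b A B f : rel_shift 0 b 0 (rel_graph A B f) = rel_graph A B (tm_shift 0 b
  f).
Proof.
rewrite /rel_shift /rel_graph /= !ty_ren_id; congr (RComp _ _ (PEq _ (App _ _) _)).
by rewrite /tm_shift !tm_ren_ren.
Qed.

Lemma rel_shift_rlolli b A B A' B' r r' :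
  rel_shift 0 b 0 (rlolli A B A' B' r r') =
  rlolli A B A' B' (rel_shift 0 b 0 r) (rel_shift 0 b 0 r').
Proof.
rewrite /rel_shift /rlolli /= !ty_ren_id.
congr (RComp _ _ (PQTm _ _ (PQTm _ _ (PImp (PRel _ _ _) (PRel _ _ _)))));
  by rewrite /rel_shift !rel_ren_ren.
Qed.

Lemma form_shift_PRel b r t u : form_shift 0 b 0 (PRel r t u) =
  PRel (rel_shift 0 b 0 r) (tm_shift 0 b t) (tm_shift 0 b u).
Proof. by []. Qed.

(** * Parametricity for algebras and their folds *)

Section Parametricity.
Variables (L : theory) (hadm : adm_class L).
Hypotheses (hext : extensionality L) (hid : identity_extension L).

(** Identity extension relates [g] to itself, and [pr_rbangE] then reduces [g] to a value. The type
    is presented as an instance of [A] in two variables because identity extension quantifies over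
    the variables of a type. *)
Lemma pr_bang_ext C H A B0 B1 X t u g :
  ctx_wf C -> ty_wf 2 A -> ty_wf (c_ty C) B0 -> ty_wf (c_ty C) B1 -> ty_wf (c_ty C) X ->
  let A' := ty_sub (sub2 B0 B1) A in
  tm_in C t (TArr A' X) -> tm_in C u (TArr A' X) -> tm_in C g (TBang A') ->
  prov L (ext_tm A' C) (pshift 0 1 0 H)
    (PEq X (App (tm_shift 0 1 t) (Bang (Var 0))) (App (tm_shift 0 1 u) (Bang (Var 0)))) ->
  prov L C H (PEq X (App t g) (App u g)).
Proof.
move=> wC wA w0 w1 wX A' ht hu hg hyp.
have env D (wD : ctx_wf D) : ty_wf (c_ty D) B0 -> ty_wf (c_ty D) B1 ->
    rel_env L D 2 [:: req B0; req B1] (sub2 B0 B1) (sub2 B0 B1).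
  by move=> w0' w1'; do 2 (apply: rel_env_cons => //; first exact: adm_eq).
have wA' : ty_wf (c_ty C) A' by apply: (ty_wf_sub wA) => -[|[|]].
have htg := tm_in_app ht hg; have hug := tm_in_app hu hg.
set Q := PAllTm A' (PEq X (App (tm_shift 0 1 t) (Bang (Var 0))) (App (tm_shift 0 1 u) (Bang
  (Var 0)))).
have hv D : tm_in (ext_tm A' D) (Bang (Var 0)) (TBang A').
  by apply: tm_in_bang; apply: tm_in_var.
apply: (@pr_cut L C H Q).
- by apply: wf_qtm => //; apply: wf_eq; apply: tm_in_app (hv _); apply: tm_in_shift_tm.
- exact: pr_allTmI.
(* The goal becomes an instance of the equality relation on [X], which is the target relation given
   to [pr_rbangE]. *)
apply: pr_reqE => //.
have hgg : prov L C (Q :: H) (PRel (RInt (TBang A) [:: req B0; req B1]) g g).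
  apply: (pr_rel_equivR hg hg (pr_id_ext2 (Q :: H) wC hid (wA : ty_wf 2 (TBang A)) w0 w1)).
  by apply: pr_reqI => //; apply: pr_eq_refl.
have {}hgg := pr_rel_equivL hg hg (pr_int_bang _ (env C wC w0 w1) wA) hgg.
apply: (pr_rbangE hadm wC wA' wA' _ hg hg wX wX _ ht hu _ hgg).
- exact: (adm_int hadm wC wA (env C wC w0 w1)).
- exact: adm_eq.
apply: pr_allTmI => //; apply: pr_allTmI => //.
rewrite rel_shift_req; set C2 := ext_tm A' (ext_tm A' C).
have wC2 : ctx_wf C2 by do 2 apply: ctx_wf_tm => //.
have e : rel_shift 0 2 0 (RInt A [:: req B0; req B1]) = RInt A [:: req B0; req B1].
  by rewrite -[in RHS](rel_shift_req 2 B0) -[in RHS](rel_shift_req 2 B1).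
rewrite e.
have hV1 : tm_in C2 (Var 1) A' by apply: tm_in_var.
have hV0 : tm_in C2 (Var 0) A' by apply: tm_in_var.
have ht2 : tm_in C2 (tm_shift 0 2 t) (TArr A' X) by apply: tm_in_shift_tm2.
have hu2 : tm_in C2 (tm_shift 0 2 u) (TArr A' X) by apply: tm_in_shift_tm2.
apply: pr_impI.
  by apply: form_wf_adm hV1 hV0 => //; apply: (adm_int hadm wC2 wA (env C2 wC2 w0 w1)).
set H2 := (_ :: _).
have hxy : prov L C2 H2 (PEq A' (Var 1) (Var 0)).
  apply: pr_reqE => //.
  apply: (pr_rel_equivL hV1 hV0 (pr_id_ext2 H2 wC2 hid wA w0 w1)).
  by apply: pr_hyp; left.
(* The hypothesis [Q] is used at x; the equation x = y then rewrites the right-hand side. *)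
have hQ : prov L C2 H2 (PEq X (App (tm_shift 0 2 t) (Bang (Var 1))) (App (tm_shift 0 2 u) (Bang
  (Var 1)))).
  (* The shift is by three: the two variables of [C2] and the one bound in [Q]. *)
  have := @pr_allTmE L C2 H2 A' (PEq X (App (tm_shift 0 3 t) (Bang (Var 0))) (App (tm_shift 0 3
    u) (Bang (Var 0)))) (Var 1) hV1.
  rewrite /form_inst_tm /= ty_sub_id.
  have e3 z : tm_sub TVar (scons (Var 1) Var) (tm_shift 0 3 z) = tm_shift 0 2 z.
    by rewrite /tm_shift tm_sub_ren tm_ren_sub_var.
  rewrite !e3; apply; apply: pr_hyp; right; left.
  rewrite /Q /form_shift /= !ty_ren_id; congr (PQTm _ _ (PEq _ (App _ _) (App _ _)));
    by rewrite /tm_shift !tm_ren_ren.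
have e4 x : form_inst_tm x (PEq X (tm_shift 0 1 (App (tm_shift 0 2 t) (Bang (Var 1))))
     (App (tm_shift 0 1 (tm_shift 0 2 u)) (Bang (Var 0)))) =
   PEq X (App (tm_shift 0 2 t) (Bang (Var 1))) (App (tm_shift 0 2 u) (Bang x)).
  rewrite /form_inst_tm /= ty_sub_id.
  by congr (PEq _ (App _ _) (App _ _)); apply: tm_inst_shift.
apply: pr_reqI => //.
- exact: tm_in_app ht2 (tm_in_bang hV1).
- exact: tm_in_app hu2 (tm_in_bang hV0).
rewrite -[X in prov _ _ _ X]e4; apply: pr_eqE hxy _; last by rewrite e4.
apply: wf_eq; first by apply: tm_in_shift_tm; apply: tm_in_app ht2 (tm_in_bang hV1).
by apply: tm_in_app (hv _); apply: tm_in_shift_tm.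
Qed.


Variables (sigma : ty).
Hypotheses (wS : ty_wf 1 sigma) (oc : occurs_only true 0 sigma).

(** Three is the length of [graph_env], in which [sigma] will be interpreted. *)
Lemma wS3 : ty_wf 3 sigma. Proof. exact: ty_wf_le wS. Qed.

Section Graph.
Variables (C : ctx) (A B : ty).
Hypotheses (wC : ctx_wf C) (wA : ty_wf (c_ty C) A) (wB : ty_wf (c_ty C) B).

Lemma ty_wf_sigma_inst : ty_wf (c_ty C) (ty_inst B sigma).
Proof. exact: (@ty_wf_inst 0). Qed.

(** Only the first relation matters for [sigma]. The equality relations interpret
    the free variables of [poly_act_type]; carrying them along everywhere avoids
    a weakening lemma for [RInt]. *)
Definition graph_env (h : tm) : seq drel :=
  [:: rel_graph A B h; req B; req (ty_inst B sigma)].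

Definition graph_src : nat -> ty := scons A (sub2 B (ty_inst B sigma)).
Definition graph_tgt : nat -> ty := scons B (sub2 B (ty_inst B sigma)).

Lemma rel_env_eq2 : rel_env L C 2 [:: req B; req (ty_inst B sigma)]
  (sub2 B (ty_inst B sigma)) (sub2 B (ty_inst B sigma)).
Proof.
have w := ty_wf_sigma_inst.
by do 2 (apply: rel_env_cons => //; first exact: adm_eq).
Qed.

Lemma rel_env_graph h : tm_in C h (TLolli A B) ->
  rel_env L C 3 (graph_env h) graph_src graph_tgt.
Proof.
by move=> hh; apply: rel_env_cons => //; [exact: adm_graph|exact: rel_env_eq2].
Qed.

Lemma graph_env_shift h : map (rel_shift 0 2 0) (graph_env h) = graph_env (tm_shift 0 2 h).
Proof. by congr [:: _; _; _]; [exact: rel_shift_graph|exact: rel_shift_req|exact: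
  rel_shift_req]. Qed.
End Graph.

(** The source of the action is made a bound type variable, so that parametricity can compare the
    action at two different sources; the target [B] stays fixed. *)
Definition poly_act (B : ty) : tm :=
  TLam (LamI (TLolli (TVar 0) (ty_ren S B)) (functor_act sigma (TVar 0) (ty_ren S B) (Var 0))).

(** The type [forall a. (a -o b) -> sigma(a) -o d] of [poly_act], where [d] stands
    for [sigma(b)]: as [d] is a variable, its relation is an equality outright,
    with no need to compute [sigma[eq]]. *)
Definition poly_act_type : ty :=
  TPi (TArr (TLolli (TVar 0) (TVar 1)) (TLolli sigma (TVar 2))).

Lemma poly_act_body_typed C B : ty_wf (c_ty C) B ->
  has_type (c_ty C).+1 (map (hyp_ren S) (map Int (c_tm C)))
    (LamI (TLolli (TVar 0) (ty_ren S B)) (functor_act sigma (TVar 0) (ty_ren S B) (Var 0)))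
    (TArr (TLolli (TVar 0) (ty_ren S B)) (TLolli sigma (ty_ren S (ty_inst B sigma)))).
Proof.
move=> wB; have wB' := ty_wf_renS wB.
apply: has_type_LamI => //.
rewrite (_ : ty_ren S (ty_inst B sigma) = ty_inst (ty_ren S B) sigma); last first.
  by rewrite !(ty_ren_sub_var _ S) ty_sub_inst.
have nl : no_linear (map (hyp_ren S) (map Int (c_tm C))) by rewrite no_linear_map.
have := @functor_act_typed sigma (c_ty C).+1
  (Int (TLolli (TVar 0) (ty_ren S B)) :: map (hyp_ren S) (map Int (c_tm C)))
  (TVar 0) (ty_ren S B) (Var 0) wS oc isT wB' nl.
by rewrite ty_inst_var0 //; apply; apply: ht_int.
Qed.

Lemma poly_act_typed C B : ty_wf (c_ty C) B ->
  tm_in C (poly_act B) (ty_sub (sub2 B (ty_inst B sigma)) poly_act_type).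
Proof.
move=> wB; apply: ht_tlam; have := poly_act_body_typed wB.
have e : ty_sub (up_ty (sub2 B (ty_inst B sigma))) sigma = sigma.
  by rewrite ty_sub_wf1 // ty_inst_var0.
by rewrite -[X in TLolli X (ty_ren S (ty_inst B sigma))]e.
Qed.

Lemma teq_poly_act C B X g : ty_wf (c_ty C) B -> ty_wf (c_ty C) X -> tm_in C g (TLolli X B) ->
  tm_eq_in C (App (TApp (poly_act B) X) (Bang g)) (functor_act sigma X B g)
    (TLolli (ty_inst X sigma) (ty_inst B sigma)).
Proof.
move=> wB wX hg.
have eB : ty_sub (scons X TVar) (ty_ren S B) = B by rewrite ty_sub_ren; apply: ty_sub_idE.
have e1 : tm_eq_in C (TApp (poly_act B) X) (LamI (TLolli X B) (functor_act sigma X B (Var 0)))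
   (TArr (TLolli X B) (TLolli (ty_inst X sigma) (ty_inst B sigma))).
  have := teq_beta_tlam (ht_tapp wX (ht_tlam (poly_act_body_typed wB))).
  rewrite /tm_tinst tm_sub_LamI functor_act_sub //= /ty_inst /= eB ty_sub_ren.
  by rewrite [X in TLolli _ (TLolli _ X)]ty_sub_idE.
apply: teq_trans (teq_app_nl (no_linear_Int _) e1 (teq_refl (tm_in_bang hg))) _.
rewrite (_ : functor_act sigma X B g = tm_inst g (functor_act sigma X B (Var 0))); last first.
  by rewrite /tm_inst functor_act_sub // !ty_sub_id.
apply: teq_beta_LamI => //; first by rewrite /= wX.
by apply: functor_act_typed; rewrite /= ?no_linear_Int //; apply: ht_int;
  rewrite /= ?no_linear_Int.
Qed.

(** The inclusion of [sigma[graph h]] in [graph (sigma h)]; the converse is not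
    needed. *)
Lemma pr_graph_functor_act C H A B h z z' :
  ctx_wf C -> ty_wf (c_ty C) A -> ty_wf (c_ty C) B -> tm_in C h (TLolli A B) ->
  tm_in C z (ty_inst A sigma) -> tm_in C z' (ty_inst B sigma) ->
  prov L C H (PRel (RInt sigma (graph_env A B h)) z z') ->
  prov L C H (PEq (ty_inst B sigma) (App (functor_act sigma A B h) z) z').
Proof.
move=> wC wA wB hh hz hz' hzz.
have wD := ty_wf_sigma_inst wB.
have env := rel_env_graph wC wA wB hh.
have hF := poly_act_typed wB.
set F := poly_act B in hF.
have hid_tm D (wBD : ty_wf (c_ty D) B) : tm_in D (Lam B (Var 0)) (TLolli B B) by apply:
  has_type_id.
have hidC := hid_tm C wB.
(* Identity extension at b = B and d = sigma(B). Next the bound type variable is instantiated with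
   the graph of h, between A and B. *)
have hFF : prov L C H (PRel (RInt poly_act_type [:: req B; req (ty_inst B sigma)]) F F).
  apply: (pr_rel_equivR hF hF (pr_id_ext2 H wC hid _ wB wD)).
    by rewrite /= wS3.
  apply: pr_reqI => //; last exact: pr_eq_refl.
  apply: (ty_wf_sub (n := 2)); first by rewrite /= wS3.
  by case=> [|[|]].
have wT : ty_wf 3 (TArr (TLolli (TVar 0) (TVar 1)) (TLolli sigma (TVar 2))) by rewrite /= wS3.
have {}hFF := pr_int_piE hadm wC (rel_env_eq2 wC wB) wT hF hF wA wB (adm_graph hadm wC wA wB
  hh) hFF.
have hFA := tm_in_tapp wA hF; have hFB := tm_in_tapp wB hF.
have hh3 : tm_in C h (ty_sub (graph_src A B) (TLolli (TVar 0) (TVar 1))) by [].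
have hid3 : tm_in C (Lam B (Var 0)) (ty_sub (graph_tgt B) (TLolli (TVar 0) (TVar 1))) by [].
have hhid : prov L C H (PRel (RInt (TLolli (TVar 0) (TVar 1)) (graph_env A B h)) h (Lam B (Var
  0))).
  apply: (pr_int_lolliI hadm wC env) => //.
  rewrite graph_env_shift; set C2 := ext_tm _ _; set H2 := (_ :: _).
  have wC2 : ctx_wf C2 by do 2 apply: ctx_wf_tm => //.
  have hh2 : tm_in C2 (tm_shift 0 2 h) (TLolli A B) by apply: tm_in_shift_tm2.
  have env2 := rel_env_graph wC2 wA wB hh2.
  have hV1 : tm_in C2 (Var 1) A by apply: tm_in_var.
  have hV0 : tm_in C2 (Var 0) B by apply: tm_in_var.
  have hid2 := hid_tm C2 wB.
  rewrite tm_shift_id_fun.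
  have ha1 : tm_in C2 (App (tm_shift 0 2 h) (Var 1)) B by apply: tm_in_app hh2 hV1.
  have ha0 : tm_in C2 (App (Lam B (Var 0)) (Var 0)) B by apply: tm_in_app hid2 hV0.
  apply: (pr_rel_equivR ha1 ha0 (pr_int_var H2 env2 (isT : 1 < 3))).
  (* The graph gives h x = y, and y = id y by beta. *)
  apply: pr_reqI => //; apply: (pr_eq_trans (u := Var 0)) => //; last first.
    by apply: pr_eqI => //; apply: teq_sym; apply: (teq_beta_lam ha0).
  apply: (pr_graphE hadm wC2 wA wB) => //.
  apply: (pr_rel_equivL hV1 hV0 (pr_int_var H2 env2 (isT : 0 < 3))).
  by apply: pr_hyp; left.
have {}hhid := pr_impE (pr_andE2 (pr_int_bang_val H env (isT : ty_wf 3 (TLolli (TVar 0) (TVar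
  1))) hh3 hid3)) hhid.
have wT1 : ty_wf 3 (TBang (TLolli (TVar 0) (TVar 1))) by [].
have wT2 : ty_wf 3 (TLolli sigma (TVar 2)) by rewrite /= wS3.
have {}hFF := pr_int_lolliE hadm wC env wT1 wT2 hFA hFB (tm_in_bang hh3) (tm_in_bang hid3) hFF
  hhid.
have hFAh := tm_in_app hFA (tm_in_bang hh3); have hFBi := tm_in_app hFB (tm_in_bang hid3).
have ez : ty_sub (graph_src A B) sigma = ty_inst A sigma by rewrite ty_sub_wf1.
have ez' : ty_sub (graph_tgt B) sigma = ty_inst B sigma by rewrite ty_sub_wf1.
have hz3 : tm_in C z (ty_sub (graph_src A B) sigma) by rewrite ez.
have hz3' : tm_in C z' (ty_sub (graph_tgt B) sigma) by rewrite ez'.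
have {}hFF := pr_int_lolliE hadm wC env wS3 (isT : ty_wf 3 (TVar 2)) hFAh hFBi hz3 hz3' hFF hzz.
have h1 := tm_in_app hFAh hz3; have h2 := tm_in_app hFBi hz3'.
have {}hFF := pr_rel_equivL h1 h2 (pr_int_var H env (isT : 2 < 3)) hFF.
have {}hFF := pr_reqE hadm wC wD h1 h2 hFF.
have h3 : tm_in C (App (functor_act sigma A B h) z) (ty_inst B sigma).
  by apply: tm_in_app hz; apply: functor_act_typed.
(* The chain is sigma(h) z = F A !h z = F B !id z' = sigma(id) z' = z'. Its middle equation is
   parametricity; the others are external equalities. *)
apply: (pr_eq_trans h3 h1 hz').
  apply: pr_eqI => //; apply: teq_sym.
  exact: (teq_app_nl (no_linear_Int _) (teq_poly_act wB wA hh) (teq_refl hz)).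
apply: (pr_eq_trans h1 h2 hz' hFF).
apply: pr_eqI => //.
have e := teq_trans (teq_poly_act wB wB hidC) (functor_act_id wS wB (no_linear_Int (c_tm C))).
apply: teq_trans (teq_app_nl (no_linear_Int _) e (teq_refl hz')) _.
by apply: teq_beta_lam; apply: tm_in_app hz'; apply: has_type_id.
Qed.

Lemma ty_sub_alg s A : ty_sub (scons A s) (TLolli sigma (TVar 0)) = alg sigma A.
Proof. by rewrite /= ty_sub_wf1. Qed.

(** Used at the graph of a fold and, in the end, at [R]. Since [mu sigma] is closed, the list [rs]
    interprets none of its variables; it is left arbitrary so that [r :: rs] can be [graph_env]. *)
Lemma pr_mu_elim C H n rs s s' A A' r x f g :
  ctx_wf C -> rel_env L C n rs s s' ->
  ty_wf (c_ty C) A -> ty_wf (c_ty C) A' -> adm L C r A A' ->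
  tm_in C x (mu sigma) -> tm_in C f (alg sigma A) -> tm_in C g (alg sigma A') ->
  prov L C H (PRel (RInt (mu sigma) rs) x x) ->
  prov L C H (PRel (RInt (TLolli sigma (TVar 0)) (r :: rs)) f g) ->
  prov L C H (PRel r (App (TApp x A) (Bang f)) (App (TApp x A') (Bang g))).
Proof.
move=> wC env wA wA' hr hx hf hg hxx hfg.
have hxs s0 : tm_in C x (ty_sub s0 (mu sigma)) by rewrite (ty_sub_closed s0 (mu_closed wS)).
have wSn : ty_wf n.+1 sigma by apply: ty_wf_le wS.
have wT0 : ty_wf n.+1 (TLolli sigma (TVar 0)) by rewrite /= wSn.
have wT : ty_wf n.+1 (TArr (TLolli sigma (TVar 0)) (TVar 0)) by rewrite /= wSn.
have {}hxx := pr_int_piE hadm wC env wT (hxs s) (hxs s') wA wA' hr hxx.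
have env' := rel_env_cons wA wA' hr env.
have hf' : tm_in C f (ty_sub (scons A s) (TLolli sigma (TVar 0))) by rewrite ty_sub_alg.
have hg' : tm_in C g (ty_sub (scons A' s') (TLolli sigma (TVar 0))) by rewrite ty_sub_alg.
have {}hfg := pr_impE (pr_andE2 (pr_int_bang_val H env' wT0 hf' hg')) hfg.
have hxA := tm_in_tapp wA (hxs s); have hxA' := tm_in_tapp wA' (hxs s').
have h := pr_int_lolliE hadm wC env' (wT0 : ty_wf n.+1 (TBang (TLolli sigma (TVar 0)))) (isT :
  ty_wf n.+1 (TVar 0))
  hxA hxA' (tm_in_bang hf') (tm_in_bang hg') hxx hfg.
exact: (pr_rel_equivL (tm_in_app hxA (tm_in_bang hf')) (tm_in_app hxA' (tm_in_bang hg'))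
  (pr_int_var H env' (isT : 0 < n.+1)) h).
Qed.

Lemma in_in C : tm_in C (in_tm sigma) (alg sigma (mu sigma)).
Proof. exact: in_typed. Qed.

Lemma tm_shift_in a b : tm_shift a b (in_tm sigma) = in_tm sigma.
Proof. by rewrite /tm_shift tm_ren_sub_var tm_sub_closed_in. Qed.

(** The point is that [in] and [f] are related by sigma[graph h] -o graph h, where h is the fold of
    [f]: from sigma(h) z = z' follows h (in z) = f (sigma(h) z) = f z'. *)
Lemma pr_fold_unique C H B f x :
  ctx_wf C -> ty_wf (c_ty C) B -> tm_in C f (alg sigma B) -> tm_in C x (mu sigma) ->
  prov L C H (PEq B (App (TApp (App (TApp x (mu sigma)) (Bang (in_tm sigma))) B) (Bang f))
                    (App (TApp x B) (Bang f))).
Proof.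
move=> wC wB hf hx; have wD := ty_wf_sigma_inst wB.
have wM D : ty_wf (c_ty D) (mu sigma) by apply: mu_wf.
set h := fold_at sigma B f.
have hh : tm_in C h (TLolli (mu sigma) B) by apply: fold_at_typed.
have env := rel_env_graph wC (wM C) wB hh.
have hxi : tm_in C (App (TApp x (mu sigma)) (Bang (in_tm sigma))) (mu sigma).
  by apply: (@ht_mu_app _ _ sigma) => //; apply: tm_in_bang; apply: in_in.
have hxf : tm_in C (App (TApp x B) (Bang f)) B.
  by apply: (@ht_mu_app _ _ sigma) => //; apply: tm_in_bang.
have hxx : prov L C H (PRel (RInt (mu sigma) [:: req B; req (ty_inst B sigma)]) x x).
  have e := ty_sub_closed (sub2 B (ty_inst B sigma)) (mu_closed wS).
  have hx' : tm_in C x (ty_sub (sub2 B (ty_inst B sigma)) (mu sigma)) by rewrite e.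
  apply: (pr_rel_equivR hx' hx' (pr_id_ext2 H wC hid (mu_wf 2 wS) wB wD)).
  by rewrite e; apply: pr_reqI => //; apply: pr_eq_refl.
have hgr : prov L C H (PRel (rel_graph (mu sigma) B h)
    (App (TApp x (mu sigma)) (Bang (in_tm sigma))) (App (TApp x B) (Bang f))).
  apply: (pr_mu_elim wC (rel_env_eq2 wC wB) (wM C) wB _ hx (in_in C) hf hxx).
    exact: adm_graph.
  have hi3 : tm_in C (in_tm sigma) (ty_sub (graph_src (mu sigma) B) (TLolli sigma (TVar 0))).
    by rewrite ty_sub_alg; apply: in_in.
  have hf3 : tm_in C f (ty_sub (graph_tgt B) (TLolli sigma (TVar 0))) by rewrite ty_sub_alg.
  apply: (pr_int_lolliI hadm wC env wS3 _ hi3 hf3) => //.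
  rewrite (ty_sub_wf1 (graph_src _ _) wS) (ty_sub_wf1 (graph_tgt _) wS).
  rewrite -[graph_src _ _ 0]/(mu sigma) -[graph_tgt _ 0]/B graph_env_shift tm_shift_in.
  set C2 := ext_tm _ _; set H2 := (_ :: _).
  have wC2 : ctx_wf C2.
    by do 2 apply: ctx_wf_tm => //; apply: ty_wf_sigma_inst.
  set h2 := tm_shift 0 2 h; set f2 := tm_shift 0 2 f.
  have eh2 : h2 = fold_at sigma B f2.
    have ef : tm_shift 0 2 (fold_tm sigma) = fold_tm sigma.
      by rewrite /tm_shift tm_ren_sub_var tm_sub_closed_fold.
    by rewrite -[h2]/(App (TApp (tm_shift 0 2 (fold_tm sigma)) (ty_ren (addn 0) B)) (Bang f2))
      ef ty_ren0.
  have hf2 : tm_in C2 f2 (alg sigma B) by apply: tm_in_shift_tm2.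
  have hh2 : tm_in C2 h2 (TLolli (mu sigma) B) by apply: tm_in_shift_tm2.
  have env2 := rel_env_graph wC2 (wM C2) wB hh2.
  have hV1 : tm_in C2 (Var 1) (ty_inst (mu sigma) sigma) by apply: tm_in_var.
  have hV0 : tm_in C2 (Var 0) (ty_inst B sigma) by apply: tm_in_var.
  have hinz : tm_in C2 (App (in_tm sigma) (Var 1)) (mu sigma) by apply: tm_in_app (in_in _) hV1.
  have hfz : tm_in C2 (App f2 (Var 0)) B by apply: tm_in_app hf2 hV0.
  apply: (pr_rel_equivR hinz hfz (pr_int_var H2 env2 (isT : 0 < 3))).
  apply: (pr_graphI hadm wC2 (wM C2) wB hh2 hinz hfz).
  have hact : tm_in C2 (App (functor_act sigma (mu sigma) B h2) (Var 1)) (ty_inst B sigma).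
    by apply: tm_in_app hV1; apply: functor_act_typed.
  apply: (pr_eq_trans (tm_in_app hh2 hinz) (tm_in_app hf2 hact) hfz).
    apply: pr_eqI; rewrite ?eh2.
    - apply: teq_trans (teq_fold_app wS (no_linear_Int _) wB hf2 hinz) _.
      exact: teq_in_app.
    - by rewrite -eh2; apply: tm_in_app hh2 hinz.
    - by rewrite -eh2; apply: tm_in_app hf2 hact.
  apply: (pr_eq_app hf2 hact hV0).
  apply: pr_graph_functor_act => //.
  by apply: pr_hyp; left.
have {}hgr := pr_graphE hadm wC (wM C) wB hh hxi hxf hgr.
have hl : tm_in C (App (TApp (App (TApp x (mu sigma)) (Bang (in_tm sigma))) B) (Bang f)) B.
  by apply: (@ht_mu_app _ _ sigma) => //; apply: tm_in_bang.
apply: (pr_eq_trans hl (tm_in_app hh hxi) hxf) hgr.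
apply: pr_eqI => //; last exact: tm_in_app hh hxi.
by apply: teq_sym; apply: teq_fold_app.
Qed.

Lemma pr_fold_in C H x : ctx_wf C -> tm_in C x (mu sigma) ->
  prov L C H (PEq (mu sigma) (App (TApp x (mu sigma)) (Bang (in_tm sigma))) x).
Proof.
move=> wC hx; set y := App _ _.
have hy : tm_in C y (mu sigma).
  by apply: (@ht_mu_app _ _ sigma) => //; [apply: mu_wf|apply: tm_in_bang; apply: in_in].
have wS1 n : ty_wf n.+1 sigma by apply: ty_wf_le wS.
set T := TLolli sigma (TVar 0).
have wT : ty_wf (c_ty C).+1 (TArr T (TVar 0)) by rewrite /= wS1.
have := hext.2 C (TArr T (TVar 0)) y x wC wT hy hx.
move=> /(pr_weak (H' := H)) h; apply: pr_impE (h _) _ => //.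
apply: pr_allTyI; set C1 := ext_ty C; set H1 := pshift _ _ _ _.
have wC1 : ctx_wf C1 by apply: ctx_wf_ty.
have em : ty_ren S (mu sigma) = mu sigma by apply: ty_ren_closed; apply: mu_closed.
have hx1 : tm_in C1 (tm_shift 1 0 x) (mu sigma) by have := tm_in_shift_ty hx; rewrite em.
have hy1 : tm_in C1 (tm_shift 1 0 y) (mu sigma) by have := tm_in_shift_ty hy; rewrite em.
have hap z : tm_in C1 z (mu sigma) -> tm_in C1 (TApp z (TVar 0)) (TArr T (TVar 0)).
  move=> hz; have := @ht_tapp _ _ _ (TVar 0) _ (isT : ty_wf (c_ty C1) (TVar 0)) hz.
  by rewrite ty_inst_mu_body // /alg ty_inst_var0.
have wT1 : ty_wf (c_ty C1) (TBang T) by rewrite /= wS1.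
have := hext.1 C1 (TBang T) (TVar 0) _ _ wC1 wT1 isT (hap _ hy1) (hap _ hx1).
move=> /(pr_weak (H' := H1)) h'; apply: pr_impE (h' _) _ => //.
apply: pr_allTmI => //; set C2 := ext_tm _ _.
have wC2 : ctx_wf C2 by apply: ctx_wf_tm.
(* [T] mentions only variable 0, so the second parameter of [pr_bang_ext] is a dummy. *)
have eT : ty_sub (sub2 (TVar 0) (TVar 0)) T = T by rewrite ty_sub_alg /alg ty_inst_var0.
have := @pr_bang_ext C2 (pshift 0 1 0 H1) T (TVar 0) (TVar 0) (TVar 0)
  (tm_shift 0 1 (TApp (tm_shift 1 0 y) (TVar 0))) (tm_shift 0 1 (TApp (tm_shift 1 0 x) (TVar
    0))) (Var 0) wC2.
cbv zeta; rewrite eT; apply=> //; try (by apply: tm_in_shift_tm; apply: hap);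
  try exact: tm_in_var.
  by rewrite /= wS1.
set C3 := ext_tm _ C2.
have wC3 : ctx_wf C3 by apply: ctx_wf_tm => //; rewrite /= wS1.
have hx3 : tm_in C3 (tm_shift 0 1 (tm_shift 0 1 (tm_shift 1 0 x))) (mu sigma).
  by do 2 apply: tm_in_shift_tm.
have hV : tm_in C3 (Var 0) (alg sigma (TVar 0)).
  by rewrite /alg ty_inst_var0 //; apply: tm_in_var.
have := pr_fold_unique (pshift 0 1 0 (pshift 0 1 0 H1)) wC3 (isT : ty_wf (c_ty C3) (TVar 0)) hV
  hx3.
(* [mu sigma] and [in] are closed, so shifting the whole application moves only its head [z]. *)
have sh a b z : App (TApp (tm_shift a b z) (mu sigma)) (Bang (in_tm sigma)) =
    tm_shift a b (App (TApp z (mu sigma)) (Bang (in_tm sigma))).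
  rewrite -[RHS]/(App (TApp (tm_shift a b z) (ty_ren (addn a) (mu sigma)))
    (Bang (tm_shift a b (in_tm sigma)))).
  by rewrite tm_shift_in ty_ren_closed // mu_closed.
by rewrite !sh.
Qed.

End Parametricity.

(** * The induction principle *)

Theorem theorem2p25
  (L : theory) (hadm : adm_class L)
  (hext : extensionality L) (hid : identity_extension L)
  (sigma : ty) (hwf : ty_wf 1 sigma) (hic : ind_constructed sigma)
  (hpos : occurs_only true 0 sigma)
  (C : ctx) (hC : ctx_wf C)
  (H : seq form) (hH : forall P, List.In P H -> form_wf L C P)
  (R : drel) (hR : adm L C R (mu sigma) (mu sigma))
  (hin : prov L C H
     (PRel (rlolli (ty_inst (mu sigma) sigma) (ty_inst (mu sigma) sigma)
                   (mu sigma) (mu sigma) (RInt sigma [:: R]) R)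
           (in_tm sigma) (in_tm sigma))) :
  prov L C H
    (PQTm All (mu sigma) (PRel (rel_shift 0 1 0 R) (Var 0) (Var 0))).
Proof.
set M := mu sigma in hR hin *.
have wM D : ty_wf (c_ty D) M by apply: mu_wf.
have wSM D : ty_wf (c_ty D) (ty_inst M sigma) by apply: ty_wf_sigma_inst.
pose s := scons M TVar.
have env D r : adm L D r M M -> rel_env L D 1 [:: r] s s.
  by move=> hr; apply: rel_env_cons (rel_env_nil _ _ _ _).
have hi D : tm_in D (in_tm sigma) (TLolli (ty_inst M sigma) M) by apply: in_in.
(* The hypothesis on [in] is recast as an interpretation of the open type sigma -o alpha at [R], the
   form that [pr_mu_elim] takes. *)
have hin' : prov L C H (PRel (RInt (TLolli sigma (TVar 0)) [:: R]) (in_tm sigma) (in_tm sigma)).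
  apply: (pr_cut _ hin).
    by apply: form_wf_rlolli => //; apply: (adm_int hadm hC hwf (env _ _ hR)).
  have hi' : tm_in C (in_tm sigma) (ty_sub s (TLolli sigma (TVar 0))) by exact: hi.
  apply: (pr_int_lolliI hadm hC (env _ _ hR) hwf (isT : ty_wf 1 (TVar 0)) hi' hi').
  rewrite -[ty_sub s sigma]/(ty_inst M sigma) tm_shift_in //.
  set C2 := ext_tm _ _; set H2 := (_ :: _).
  have wC2 : ctx_wf C2 by do 2 apply: ctx_wf_tm => //.
  have hR2 : adm L C2 (rel_shift 0 2 0 R) M M by apply: adm_shift_tm2.
  have hV1 : tm_in C2 (Var 1) (ty_inst M sigma) by apply: tm_in_var.
  have hV0 : tm_in C2 (Var 0) (ty_inst M sigma) by apply: tm_in_var.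
  have h1 := tm_in_app (hi C2) hV1; have h0 := tm_in_app (hi C2) hV0.
  apply: (pr_rel_equivR h1 h0 (pr_int_var H2 (env _ _ hR2) (isT : 0 < 1))).
  have hi2 := adm_int hadm wC2 hwf (env _ _ hR2).
  apply: (pr_rlolliE hadm wC2 (wSM C2) (wSM C2) (wM C2) (wM C2) hi2 hR2 (hi C2) (hi C2) hV1 hV0).
    apply: pr_hyp; right; left.
    have es r : rel_shift 0 1 0 (rel_shift 0 1 0 r) = rel_shift 0 2 0 r.
      by rewrite /rel_shift rel_ren_ren.
    by rewrite !form_shift_PRel !rel_shift_rlolli !tm_shift_in // !es.
  by apply: pr_hyp; left.
apply: pr_cut hin' _.
  have wT : ty_wf 1 (TLolli sigma (TVar 0)) by rewrite /= hwf.
  exact: (form_wf_adm hadm hC (adm_int hadm hC wT (env _ _ hR)) (hi C) (hi C)).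
apply: pr_allTmI => //; set C1 := ext_tm _ _; set H1 := pshift _ _ _ _.
have wC1 : ctx_wf C1 by apply: ctx_wf_tm.
have hx : tm_in C1 (Var 0) M by apply: tm_in_var.
have hR1 : adm L C1 (rel_shift 0 1 0 R) M M.
  by have := adm_wk hadm (wk_ext_tm M (wk0 C)) hC wC1 hR; rewrite !ty_ren0.
have hxx := pr_id_ext0 hadm H1 wC1 hid (mu_closed hwf) hx.
set y := App (TApp (Var 0) M) (Bang (in_tm sigma)).
have hy : tm_in C1 y M by apply: (@ht_mu_app _ _ sigma) => //; apply: tm_in_bang.
have hyy : prov L C1 H1 (PRel (rel_shift 0 1 0 R) y y).
  apply: (pr_mu_elim hadm hwf wC1 (rel_env_nil L C1 TVar TVar) (wM C1) (wM C1) hR1 hx (hi C1)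
    (hi C1) hxx).
  apply: pr_hyp; left.
  by rewrite form_shift_PRel tm_shift_in.
have hyx : prov L C1 H1 (PEq M y (Var 0)) by apply: pr_fold_in.
(* Replacement in the predicate R(z, z) exchanges both occurrences of y for x at once. *)
have e z : form_inst_tm z (PRel (rel_shift 0 2 0 R) (Var 0) (Var 0)) = PRel (rel_shift 0 1 0 R)
  z z.
  by rewrite /form_inst_tm /= /rel_shift rel_sub_ren rel_ren_sub_var.
rewrite -[X in prov _ _ _ X]e; apply: pr_eqE hyx _; last by rewrite e.
have wC2 : ctx_wf (ext_tm M C1) by apply: ctx_wf_tm.
by apply: (form_wf_adm hadm wC2 (adm_shift_tm2 hadm hC wC2 hR)); apply: tm_in_var.
Qed.
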